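(* Let $n\ge1$, let $\Omega\subset\mathbb{R}^n$ be a domain and let $u:\Omega\to\mathbb{R}$ be a $C^2$ function. For $x\in\Omega$ let $\lambda_1(x),\dots,\lambda_n(x)$ be the eigenvalues of $D^2u(x)$. Assume that one of the following three cases holds. (1) $u$ satisfies $$-\sqrt{2}\sum_{i=1}^n\frac{1}{1+\lambda_i}=-u+\frac12\langle x,Du\rangle\quad\text{in }\Omega,$$ and is admissible, i.e. $D^2u>-I$ on all of $\Omega$ or $D^2u<-I$ on all of $\Omega$. (2) For some $\tau\in(0,\frac{\pi}{4})$, with $a=\cot\tau$ and $b=\sqrt{\cot^2\tau-1}$, $u$ satisfies $$\frac{\sqrt{a^2+1}}{2b}\sum_{i=1}^n\ln\frac{\lambda_i+a-b}{\lambda_i+a+b}=-u+\frac12\langle x,Du\rangle\quad\text{in }\Omega,$$ and is admissible, i.e. $D^2u>-(a-b)I$ on all of $\Omega$ or $D^2u<-(a+b)I$ on all of $\Omega$. (3) For some $\tau\in(\frac{\pi}{4},\frac{\pi}{2})$, with $a=\cot\tau$ and $b=\sqrt{1-\cot^2\tau}$, one has $\lambda_i(x)\ne-(a+b)$ for all $x\in\Omega$ and all $i$ (so that the following expression is defined) and $u$ satisfies $$\frac{\sqrt{a^2+1}}{b}\sum_{i=1}^n\arctan\frac{\lambda_i+a-b}{\lambda_i+a+b}=-u+\frac12\langle x,Du\rangle\quad\text{in }\Omega.$$ Assume moreover that $|Du|=\infty$ on $\partial\Omega$ or $|u|=\infty$ on $\partial\Omega$. Then $\Omega=\mathbb{R}^n$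 and $u$ is a quadratic polynomial.
   Context: A domain is a nonempty connected open set. $\langle\cdot,\cdot\rangle$ is the standard inner product on $\mathbb{R}^n$, $Du$ is the gradient, $I$ is the identity matrix, and inequalities between symmetric matrices are in the sense of quadratic forms (strict inequality means the difference is positive definite). ''$|Du|=\infty$ on $\partial\Omega$'' means that $|Du(x)|\to\infty$ as $x\in\Omega$ tends to any point of $\partial\Omega$; similarly ''$|u|=\infty$ on $\partial\Omega$'' means $|u(x)|\to\infty$ as $x\in\Omega$ tends to any point of $\partial\Omega$ (both conditions are vacuous if $\partial\Omega=\emptyset$). ''Quadratic polynomial'' means a polynomial of degree at most $2$. *)

(* Defs.v *)
From HB Require Import structures.
From mathcomp Require Import all_boot all_order all_algebra.
From mathcomp Require Import all_classical all_reals all_analysis.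
(* The notations of mpoly clash with those of all_analysis. *)
From mathcomp Require Import -(notations) mpoly.

Set Implicit Arguments.
Unset Strict Implicit.
Unset Printing Implicit Defensive.

Import Order.TTheory GRing.Theory Num.Theory.
Import numFieldNormedType.Exports.

Local Open Scope classical_set_scope.
Local Open Scope ring_scope.

Section Defs.
Variables (R : realType) (n : nat).
Implicit Types (Omega : set 'rV[R]_n) (u : 'rV[R]_n -> R) (A B : 'M[R]_n).

Definition dot (x y : 'rV[R]_n) : R := \sum_(i < n) x 0 i * y 0 i.

(* The library norm on 'rV[R]_n is the maximum norm. *)
Definition enorm (x : 'rV[R]_n) : R := Num.sqrt (dot x x).

Definition domain Omega : Prop := [/\ Omega !=set0, open Omega & connected Omega].

Definition boundary Omega : set 'rV[R]_n := closure Omega `\` Omega°.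

Definition partial (i : 'I_n) u : 'rV[R]_n -> R := fun x => 'D_'e_i u x.

Definition gradient u x : 'rV[R]_n := \row_i partial i u x.

Definition hessian u x : 'M[R]_n := \matrix_(i, j) partial j (partial i u) x.

(* A function on an open set Omega is represented by a total function; its
   derivatives at points of Omega depend only on its values on Omega. *)
Definition C1_on Omega u : Prop := forall x, Omega x ->
  {for x, continuous u} /\
  forall i, derivable u x 'e_i /\ {for x, continuous (partial i u)}.

Definition C2_on Omega u : Prop :=
  C1_on Omega u /\ forall i, C1_on Omega (partial i u).

Definition posdef A : Prop := forall v : 'rV[R]_n, v != 0 -> 0 < dot (v *m A) v.

Definition mx_lt A B : Prop := posdef (B - A).

(* l lists the eigenvalues of A, with multiplicity, in some order. *)
Definition eigenvalues A (l : 'I_n -> R) : Prop :=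
  char_poly A = \prod_(i < n) ('X - (l i)%:P).

Definition blows_up_at_boundary Omega (g : 'rV[R]_n -> R) : Prop :=
  forall p, boundary Omega p -> g x @[x --> within Omega (nbhs p)] --> +oo.

(* msize is the total degree plus one. *)
Definition quadratic_polynomial u : Prop :=
  exists2 p : mpoly n R, (msize p <= 3)%N &
    forall x : 'rV[R]_n, u x = meval (fun i => x 0 i) p.

End Defs.

Definition cot (R : realType) (t : R) : R := cos t / sin t.

(* Main.v *)
(* Write the equation as F(D^2 u) = theta with F(D^2 u) = sum_i f(lambda_i) and
   theta = - u + <x, Du> / 2.  Differentiating twice formally gives the linear
   elliptic equation F^{ij} theta_ij = <x, D theta> / 2; as u is only C^2, it is
   replaced by a comparison of u with its rescalings
   (1 + t)^-2 u(c + (1 + t)(x - c)) near points where theta is touched by a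
   quadratic.  Since f'(s) (1 + s^2) is bounded where theta is bounded below,
   F^{ij} phi_ij is morally bounded for phi = |x|^2 + |Du|^2, while the drift
   <x, D phi> / 2 is comparable to phi.  Hence the maxima of theta - eps phi,
   which exist because the blow-up condition makes {theta >= m, phi <= C}
   compact, stay where phi is bounded, and theta attains its maximum.  By the
   strong maximum principle theta is constant.  Then D^2 u(x) x = Du(x), so Du is
   homogeneous of degree one along rays; by the blow-up condition rays never
   leave Omega and neither do their limits, so 0 lies in Omega and Omega is the
   whole space.  Finally D^2 u is homogeneous of degree zero and continuous at 0,
   hence constant.  The second alternatives of cases (1) and (2) follow by
   passing to - u. *)
Require Import Defs.
From HB Require Import structures.
From mathcomp Require Import all_boot all_order all_fingroup all_algebra.
From mathcomp Require Import all_classical all_reals all_analysis.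
From mathcomp Require Import ring lra.
From mathcomp Require Import -(notations) mpoly.

Set Implicit Arguments.
Unset Strict Implicit.
Unset Printing Implicit Defensive.

Import Order.TTheory GRing.Theory Num.Theory.
Import numFieldNormedType.Exports.

Local Open Scope classical_set_scope.
Local Open Scope ring_scope.

(** In all three cases f'(s) = sqrt (a^2 + 1) / (s^2 + 2 a s + 1), with a = 1 in case (1); the cases
    differ by the real roots of the denominator. To the right of the largest root f tends to minus
    infinity at that root, so a lower bound on f keeps s away from it; to the left of the smallest
    root f blows up with the other sign, whence the passage to - u. The rescaling of u by 1 + t
    about c has at x the Hessian of u at the dilated point. Comparing it with u where their
    difference is touched thus compares two values of F(D^2 u), that is two values of theta, and
    dividing by t replaces the differentiated equation. The price is that the inequality holds at a
    nearby point y instead of x0, so every estimate has to be stable near x0. Moving the centre c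
    adds a linear function of Du to W. This is what handles the penalty |Du|^2: near x0 it is a
    linear function of Du plus |Du - Du(x0)|^2, and the latter is quadratic in x - x0 up to a small
    error since Du is differentiable. *)

Section Dot.
Variables (R : realType) (n : nat).
Implicit Types (x y v : 'rV[R]_n).

Lemma dot_mxE x y : dot x y = (x *m y^T) 0 0.
Proof. by rewrite mxE; apply: eq_bigr => i _; rewrite !mxE. Qed.

Lemma dotC x y : dot x y = dot y x.
Proof. by apply: eq_bigr => i _; rewrite mulrC. Qed.

Lemma dotDl x y v : dot (x + y) v = dot x v + dot y v.
Proof. by rewrite !dot_mxE mulmxDl mxE. Qed.

Lemma dotZl a x y : dot (a *: x) y = a * dot x y.
Proof. by rewrite !dot_mxE -scalemxAl mxE. Qed.

Lemma dotNl x y : dot (- x) y = - dot x y.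
Proof. by rewrite -scaleN1r dotZl mulN1r. Qed.

Lemma dotBl x y v : dot (x - y) v = dot x v - dot y v.
Proof. by rewrite dotDl dotNl. Qed.

Lemma dotDr x y v : dot v (x + y) = dot v x + dot v y.
Proof. by rewrite dotC dotDl !(dotC v). Qed.

Lemma dotZr a x y : dot x (a *: y) = a * dot x y.
Proof. by rewrite dotC dotZl dotC. Qed.

Lemma dotNr x y : dot x (- y) = - dot x y.
Proof. by rewrite dotC dotNl dotC. Qed.

Lemma dotBr x y v : dot v (x - y) = dot v x - dot v y.
Proof. by rewrite dotDr dotNr. Qed.

Lemma dot0l x : dot 0 x = 0.
Proof. by rewrite -(scale0r 0) dotZl mul0r. Qed.

Lemma dot0r x : dot x 0 = 0.
Proof. by rewrite dotC dot0l. Qed.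

Lemma dot_ge0 x : 0 <= dot x x.
Proof. by apply: sumr_ge0 => i _; rewrite -expr2 sqr_ge0. Qed.

Lemma dot_eq0 x : (dot x x == 0) = (x == 0).
Proof.
apply/idP/eqP => [|->]; last by rewrite dot0l.
rewrite psumr_eq0 => [|i _]; last by rewrite -expr2 sqr_ge0.
move=> /allP h; apply/rowP => i; rewrite mxE.
by have := h i (mem_index_enum _); rewrite -expr2 sqrf_eq0 => /eqP.
Qed.

Lemma dot_gt0 x : x != 0 -> 0 < dot x x.
Proof. by move=> x0; rewrite lt_def dot_eq0 x0 dot_ge0. Qed.

Lemma dot_mulmx x y (A : 'M[R]_n) : dot (x *m A) y = dot x (y *m A^T).
Proof. by rewrite !dot_mxE trmx_mul trmxK mulmxA. Qed.

Lemma dot_mulmxE (A : 'M[R]_n) x : dot (x *m A) x = \sum_i \sum_j A i j * (x 0 i * x 0 j).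
Proof.
rewrite /dot exchange_big /=; apply: eq_bigr => j _.
rewrite mxE big_distrl /=; apply: eq_bigr => i _.
by rewrite mulrA (mulrC (A i j)).
Qed.

Lemma dot_sqrD x y : dot (x + y) (x + y) = dot x x + 2 * dot x y + dot y y.
Proof. by rewrite !dotDl !dotDr (dotC y x); ring. Qed.

Lemma dot_double_le x y : 2 * dot x y <= dot x x + dot y y.
Proof.
have := dot_ge0 (x - y).
by rewrite dotBl !dotBr (dotC y x) => ?; lra.
Qed.

End Dot.

(** * Spectral theorem, Weyl's inequality and quadratic forms *)

Section Spectral.
Variable R : realType.

Definition mx_le n (A B : 'M[R]_n) :=
  forall v : 'rV[R]_n, dot (v *m A) v <= dot (v *m B) v.

Definition spec n (A : 'M[R]_n) (l : 'I_n -> R) := exists2 P : 'M[R]_n,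
  P *m P^T = 1%:M & A = P^T *m diag_mx (\row_i l i) *m P.

Lemma orthogonal_trV n (P : 'M[R]_n) : P *m P^T = 1%:M -> P^T *m P = 1%:M.
Proof. exact: mulmx1C. Qed.

(** The reflection along e - v exchanges the unit vectors e and v; it degenerates when e = v, where
    the identity serves. *)
Lemma householder n (v : 'rV[R]_n.+1) : dot v v = 1 ->
  exists2 H : 'M[R]_n.+1, H *m H^T = 1%:M & row 0 H = v.
Proof.
move=> v1; pose e : 'rV[R]_n.+1 := delta_mx 0 0.
have eE x : dot e x = x 0 0.
  rewrite /dot (bigD1 ord0) //= mxE !eqxx mul1r big1 ?addr0 // => i i0.
  by rewrite mxE (negbTE i0) mul0r.
have [ev|ev] := eqVneq (e - v) 0.
  exists 1%:M; first by rewrite mul1mx trmx1.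
  by rewrite rowE mulmx1; apply/subr0_eq.
pose w := e - v.
have wp := dot_gt0 ev; rewrite -/w in wp.
have wE : dot w w = 2 * dot e w.
  by rewrite /w !(dotBl, dotBr) v1 !eE (dotC v e) eE !mxE !eqxx /=; ring.
pose c := 2 / dot w w.
have wwT : w *m w^T = (dot w w)%:M by rewrite [LHS]mx11_scalar dot_mxE.
pose H := 1%:M - c *: (w^T *m w).
have HT : H^T = H by rewrite linearB /= trmx1 linearZ /= trmx_mul trmxK.
exists H.
  have NN : w^T *m w *m (w^T *m w) = dot w w *: (w^T *m w).
    by rewrite mulmxA -(mulmxA w^T) wwT mul_mx_scalar -scalemxAl.
  rewrite HT /H; move: (w^T *m w) NN => N NN.
  rewrite mulmxBl mul1mx mulmxBr mulmx1 -!scalemxAl -scalemxAr NN !scalerA.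
  have -> : c * c * dot w w = c + c by rewrite /c; field; rewrite gt_eqF.
  by rewrite scalerDl opprB addrK subrK.
rewrite rowE -/e /H mulmxBr mulmx1 -scalemxAr mulmxA.
have -> : e *m w^T = (dot e w)%:M by rewrite [LHS]mx11_scalar dot_mxE.
rewrite mul_scalar_mx scalerA /c wE.
have ew : dot e w != 0 by move: wp; rewrite wE pmulr_rgt0 // => /gt_eqF ->.
rewrite (_ : _ * _ = 1); last by field.
by rewrite scale1r /w opprB addrC subrK.
Qed.

Lemma char_poly_similar n (A Q : 'M[R]_n) : Q *m Q^T = 1%:M ->
  char_poly (Q *m A *m Q^T) = char_poly A.
Proof.
move=> QQ; rewrite /char_poly.
pose q := map_mx polyC Q.
have qT : q^T = map_mx polyC Q^T by apply/matrixP => i j; rewrite !mxE.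
have qq : q *m q^T = 1%:M by rewrite qT /q -map_mxM QQ map_mx1.
have -> : char_poly_mx (Q *m A *m Q^T) = q *m char_poly_mx A *m q^T.
  rewrite /char_poly_mx mulmxBr mulmxBl !map_mxM -qT; congr (_ - _).
  by rewrite mul_mx_scalar -scalemxAl qq scalemx1.
rewrite !det_mulmx mulrAC -det_mulmx qq det1 mul1r //.
Qed.

Lemma block_diag_conj m n (a : 'M[R]_m) (P D : 'M[R]_n) :
  (block_mx 1%:M 0 0 P)^T *m block_mx a 0 0 D *m block_mx 1%:M 0 0 P
  = block_mx a 0 0 (P^T *m D *m P).
Proof.
rewrite tr_block_mx trmx1 !trmx0 !mulmx_block.
by rewrite !(mulmx0, mul0mx, addr0, add0r, mul1mx, mulmx1).
Qed.

(** Induction on n. The split characteristic polynomial supplies a real eigenvector; a Householder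
    matrix moves it to the first basis vector, symmetry clears the first row and column, and
    cancelling the factor X - l 0 passes the hypothesis on to the remaining block. *)
Lemma symmetric_spec n (A : 'M[R]_n) (l : 'I_n -> R) :
  A^T = A -> eigenvalues A l -> spec A l.
Proof.
rewrite /eigenvalues; elim: n A l => [|n IH] A l As chA.
  by exists 0; rewrite [LHS]flatmx0 ?[RHS]flatmx0.
have : eigenvalue A (l 0).
  rewrite eigenvalue_root_char chA big_ord_recl rootM root_XsubC eqxx //.
case/eigenvalueP => v vA v0.
have vp := dot_gt0 v0.
pose v1 := (Num.sqrt (dot v v))^-1 *: v.
have v11 : dot v1 v1 = 1.
  rewrite dotZl dotZr mulrA -expr2 exprVn sqr_sqrtr ?dot_ge0 //.
  by rewrite mulVf // gt_eqF.
have v1A : v1 *m A = l 0 *: v1 by rewrite -scalemxAl vA !scalerA mulrC.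
have [H HH H0] := householder v11.
pose B : 'M[R]_(1 + n) := H *m A *m H^T.
have Bs : B^T = B by rewrite !trmx_mul trmxK As mulmxA.
have B0 : row 0 B = l 0 *: delta_mx 0 0.
  by rewrite /B !row_mul H0 v1A -scalemxAl -H0 -row_mul HH row1.
have chB : char_poly B = char_poly A by apply: char_poly_similar.
have AB : A = H^T *m B *m H.
  by rewrite /B !mulmxA orthogonal_trV // mul1mx -mulmxA orthogonal_trV // mulmx1.
clearbody B.
have ul : ulsubmx B = (l 0)%:M.
  apply/matrixP => i j; rewrite !ord1 !mxE.
  have := congr1 (fun M : 'rV_n.+1 => M 0 0) B0; rewrite !mxE !eqxx mulr1n mulr1 => <-.
  by congr (B _ _); apply/val_inj.
have ur : ursubmx B = 0.
  apply/matrixP => i j; rewrite !ord1 !mxE.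
  have := congr1 (fun M : 'rV_n.+1 => M 0 (rshift 1 j)) B0; rewrite !mxE /= mulr0 => <-.
  by congr (B _ _); apply/val_inj.
have dl : dlsubmx B = 0 by rewrite -[B]Bs -trmx_ursub ur trmx0.
have BE : B = block_mx (l 0)%:M 0 0 (drsubmx B) by rewrite -[LHS]submxK ul ur dl.
have [||P PP BP] := IH (drsubmx B) (fun i => l (lift ord0 i)).
- by rewrite trmx_drsub Bs.
- move: chB; rewrite {1}BE /char_poly char_block_diag_mx det_ublock -/(char_poly _) -/(char_poly _).
  rewrite -/(char_poly A) chA big_ord_recl.
  have -> : \det (char_poly_mx ((l 0)%:M : 'M[R]_1)) = 'X - (l 0)%:P.
    by rewrite det_mx11 !mxE !eqxx !mulr1n.
  by apply: mulfI; rewrite polyXsubC_eq0.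
pose P1 : 'M[R]_(1 + n) := block_mx 1%:M 0 0 P.
have P1P1 : P1 *m P1^T = 1%:M.
  rewrite tr_block_mx trmx1 !trmx0 mulmx_block !mulmx0 !mul0mx !addr0 add0r.
  by rewrite mul1mx PP -scalar_mx_block.
exists (P1 *m H).
  by rewrite trmx_mul mulmxA -(mulmxA P1) HH mulmx1.
rewrite AB trmx_mul !mulmxA; congr (_ *m _); rewrite -!mulmxA; congr (_ *m _).
rewrite BE BP mulmxA.
have -> : diag_mx (\row_i l i) =
    block_mx (l 0)%:M 0 0 (diag_mx (\row_i l (lift ord0 i))) :> 'M[R]_(1 + n).
  pose r : 'rV[R]_n := \row_i l (lift ord0 i).
  transitivity (diag_mx (row_mx (l 0)%:M r)); last first.
    rewrite diag_mx_row; congr (block_mx _ _ _ _).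
    by apply/matrixP => i j; rewrite !ord1 !mxE.
  congr diag_mx; apply/rowP => i; rewrite mxE [RHS]mxE; case: splitP => j ji.
    by rewrite ord1 mxE eqxx mulr1n; congr l; apply/val_inj; rewrite /= ji ord1.
  by rewrite mxE; congr l; apply/val_inj; rewrite /= ji.
exact: (esym (@block_diag_conj 1 n (l 0)%:M P _)).
Qed.

Lemma spec_quad n (l : 'I_n -> R) (P : 'M[R]_n) (v : 'rV[R]_n) :
  dot (v *m (P^T *m diag_mx (\row_i l i) *m P)) v
  = \sum_i l i * ((v *m P^T) 0 i) ^+ 2.
Proof.
rewrite !mulmxA dot_mulmx; apply: eq_bigr => i _.
by rewrite mul_mx_diag !mxE; rewrite -mulrA mulrCA expr2.
Qed.

Lemma orthogonal_dot n (P : 'M[R]_n) (v : 'rV[R]_n) : P *m P^T = 1%:M ->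
  dot v v = \sum_i ((v *m P^T) 0 i) ^+ 2.
Proof.
move=> PP; have := @spec_quad n (fun=> 1) P v.
rewrite (_ : diag_mx _ = 1%:M); last first.
  by apply/matrixP => i j; rewrite !mxE.
rewrite mulmx1 orthogonal_trV // mulmx1 => ->.
by apply: eq_bigr => i _; rewrite mul1r.
Qed.

(* Weyl's monotonicity: the n - 1 linear conditions below have a nonzero
   common solution v, on which A is at least l i and B at most m i. *)
Lemma weyl n (A B : 'M[R]_n) (l m : 'I_n -> R) :
  {homo l : i j / (i <= j)%N >-> i <= j} ->
  {homo m : i j / (i <= j)%N >-> i <= j} ->
  spec A l -> spec B m -> mx_le A B -> forall i, l i <= m i.
Proof.
move=> lm mm [P PP ->] [Q QQ ->] AB i.
rewrite leNgt; apply/negP => mli.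
(* The conditions are the columns of a square matrix whose column [i] is left zero, so that
   singularity is immediate and [v] is a left kernel vector. *)
pose M := \matrix_(a, j) if (j < i)%N then P^T a j else
                         if (i < j)%N then Q^T a j else 0.
have /det0P [v v0 vM] : \det M == 0.
  rewrite -det_tr; apply/det0P; exists (delta_mx 0 i).
    apply/eqP => /rowP /(_ i); rewrite !mxE !eqxx => /eqP.
    by rewrite oner_eq0.
  by rewrite -rowE; apply/rowP => j; rewrite !mxE ltnn.
have vP (j : 'I_n) : (j < i)%N -> (v *m P^T) 0 j = 0.
  move=> ji; have /rowP /(_ j) := vM; rewrite !mxE => E.
  by rewrite -[RHS]E; apply: eq_bigr => a _; rewrite !mxE ji.
have vQ (j : 'I_n) : (i < j)%N -> (v *m Q^T) 0 j = 0.
  move=> ji; have /rowP /(_ j) := vM; rewrite !mxE => E.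
  by rewrite -[RHS]E; apply: eq_bigr => a _; rewrite !mxE ltnNge ltnW ?ji.
have vp := dot_gt0 v0.
have h1 : l i * dot v v <= \sum_j l j * ((v *m P^T) 0 j) ^+ 2.
  rewrite (orthogonal_dot v PP) big_distrr /=; apply: ler_sum => j _.
  have [ji|ij] := ltnP j i; first by rewrite vP // expr0n !mulr0.
  by rewrite ler_wpM2r ?sqr_ge0 // lm.
have h2 : \sum_j m j * ((v *m Q^T) 0 j) ^+ 2 <= m i * dot v v.
  rewrite (orthogonal_dot v QQ) big_distrr /=; apply: ler_sum => j _.
  have [ji|ij] := ltnP i j; first by rewrite vQ // expr0n !mulr0.
  by rewrite ler_wpM2r ?sqr_ge0 // mm.
have := AB v; rewrite !spec_quad => h3.
have := le_trans h1 (le_trans h3 h2).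
by rewrite ler_pM2r // leNgt mli.
Qed.

(** The comparison matrices fed to [weyl] are polynomials in a Hessian, so they share its
    eigenvectors and their eigenvalues are explicit. *)
Lemma spec_poly n (A : 'M[R]_n) (l : 'I_n -> R) (a b c : R) : spec A l ->
  spec (a%:M + b *: A + c *: (A *m A)) (fun i => a + b * l i + c * l i ^+ 2).
Proof.
case=> P PP ->; exists P => //.
set D := diag_mx _.
have DD : D *m D = diag_mx (\row_i (l i) ^+ 2).
  by rewrite mulmx_diag; congr diag_mx; apply/rowP => i; rewrite !mxE expr2.
have -> : P^T *m D *m P *m (P^T *m D *m P) = P^T *m (D *m D) *m P.
  by rewrite !mulmxA -(mulmxA (P^T *m D) P) PP mulmx1.
have -> : a%:M = P^T *m (a%:M : 'M[R]_n) *m P.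
  by rewrite mul_mx_scalar -scalemxAl orthogonal_trV // scalemx1.
have -> : diag_mx (\row_i (a + b * l i + c * l i ^+ 2))
    = a%:M + b *: D + c *: diag_mx (\row_i (l i) ^+ 2) :> 'M[R]_n; last first.
  by rewrite DD !mulmxDr !mulmxDl -!scalemxAr -!scalemxAl.
by apply/matrixP => i j; rewrite !mxE; case: eqP => [->|_]; rewrite ?mulr1n // !mulr0n; ring.
Qed.

Lemma spec_trace n (A : 'M[R]_n) (l : 'I_n -> R) : spec A l -> \tr A = \sum_i l i.
Proof.
case=> P PP ->; rewrite mxtrace_mulC mulmxA PP mul1mx mxtrace_diag.
by apply: eq_bigr => i _; rewrite mxE.
Qed.

Lemma mx_le_trace n (A B : 'M[R]_n) : mx_le A B -> \tr A <= \tr B.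
Proof.
move=> AB; apply: ler_sum => i _.
have E (M : 'M[R]_n) : dot (delta_mx 0 i *m M) (delta_mx 0 i) = M i i.
  rewrite -rowE /dot (bigD1 i) //= big1 ?addr0 ?mxE ?eqxx ?mulr1 // => j ji.
  by rewrite !mxE (negbTE ji) andbF mulr0.
by have := AB (delta_mx 0 i); rewrite !E.
Qed.

(** Sum |v_i v_j| <= (v_i^2 + v_j^2) / 2 over all pairs of indices. *)
Lemma mx_dist_le n (A B : 'M[R]_n) (d : R) : 0 <= d ->
  (forall i j, `|A i j - B i j| <= d) -> mx_le A (B + (n%:R * d)%:M).
Proof.
move=> d0 AB v; rewrite mulmxDr dotDl -lerBlDl -dotBl -mulmxBr mul_mx_scalar dotZl.
rewrite dot_mulmxE.
apply: (@le_trans _ _ (\sum_i \sum_j d * ((v 0 i ^+ 2 + v 0 j ^+ 2) / 2))).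
  apply: ler_sum => i _; apply: ler_sum => j _; rewrite !mxE.
  apply: (le_trans (ler_norm _)); rewrite normrM ler_pM // ?normr_ge0 //.
  rewrite normrM; have := sqr_ge0 (`|v 0 i| - `|v 0 j|).
  rewrite -(real_normK (num_real (v 0 i))) -(real_normK (num_real (v 0 j))).
  by move=> h; nra.
rewrite le_eqVlt; apply/orP; left; apply/eqP.
transitivity (\sum_(i < n) (d / 2 * (n%:R * v 0 i ^+ 2) + d / 2 * dot v v)).
  apply: eq_bigr => i _; rewrite -big_distrr /= -mulr_suml big_split /=.
  rewrite sumr_const card_ord -mulr_natl (_ : \sum_(i < n) v 0 i ^+ 2 = dot v v); last first.
    by apply: eq_bigr => j _; rewrite expr2.
  by field.
rewrite big_split /= -!mulr_sumr sumr_const card_ord -mulr_natl.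
rewrite (_ : \sum_(i < n) v 0 i ^+ 2 = dot v v); first by field.
by apply: eq_bigr => j _; rewrite expr2.
Qed.

(** [weyl] compares increasing lists, whereas the theorem allows the eigenvalues in any order. *)
Lemma eigenvalues_sort n (A : 'M[R]_n) (l : 'I_n -> R) : eigenvalues A l ->
  exists m : 'I_n -> R, [/\ {homo m : i j / (i <= j)%N >-> i <= j},
    eigenvalues A m & exists s : {perm 'I_n}, forall i, m i = l (s i)].
Proof.
move=> Al; pose t := [tuple l i | i < n].
have st : size (sort <=%R t) == n by rewrite size_sort size_tuple.
pose t' : n.-tuple R := Tuple st.
have /tuple_permP [s sE] : perm_eq t' t by rewrite /= perm_sort.
pose m i := l (s i).
have mE i : m i = tnth t' i.
  rewrite (tnth_nth 0) sE /= (nth_map i) ?size_enum_ord //.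
  by rewrite nth_ord_enum tnth_mktuple.
exists m; split.
- move=> i j ij; rewrite !mE !(tnth_nth 0).
  apply: (sorted_leq_nth le_trans (@lexx _ _)) => //; rewrite ?inE ?size_tuple //.
  exact: sort_le_sorted.
- by rewrite /eigenvalues Al (reindex_inj (@perm_inj _ s)).
- by exists s.
Qed.

End Spectral.

(** * Directional derivatives and first order expansion *)

Section Calculus.
Variables (R : realType) (n : nat).
Implicit Types (x y v h p : 'rV[R]_n) (g u : 'rV[R]_n -> R) (Omega : set 'rV[R]_n).

(** Neighbourhoods come from the maximum norm, while all geometric arguments use Euclidean balls. *)
Lemma nbhs_dotP x (P : set 'rV[R]_n) : nbhs x P <->
  exists2 r, 0 < r & forall y, dot (y - x) (y - x) <= r -> P y.
Proof.
split=> [/nbhs_ballP [e e0 eP]|[r r0 rP]].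
  exists ((e / 2) ^+ 2) => [|y yr]; first by rewrite exprn_gt0 // divr_gt0.
  apply: eP; split=> // i j; rewrite !ord1 /ball /= distrC.
  have : (y 0 j - x 0 j) ^+ 2 <= (e / 2) ^+ 2.
    apply: le_trans yr; rewrite /dot (bigD1 j) //= !mxE -expr2 lerDl.
    by apply: sumr_ge0 => k _; rewrite -expr2 sqr_ge0.
  rewrite -ler_sqrt ?sqr_ge0 // !sqrtr_sqr => /le_lt_trans; apply.
  by rewrite gtr0_norm ?divr_gt0 // ltr_pdivrMr // ltr_pMr // ltr1n.
(* As d <= 1, a coordinate difference below d has square at most r / (n + 1); there are n
   coordinates. *)
pose d := Num.min 1 (r / n.+1%:R).
have d0 : 0 < d by rewrite lt_min ltr01 divr_gt0 // ltr0n.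
apply/nbhs_ballP; exists d => // y [_ yd]; apply: rP.
apply: (@le_trans _ _ (\sum_(i < n) r / n.+1%:R)).
  apply: ler_sum => i _; rewrite !mxE.
  have := ltW (yd 0 i); rewrite /= distrC => h.
  rewrite -expr2 -(real_normK (num_real _)) expr2.
  apply: (@le_trans _ _ (1 * (r / n.+1%:R))).
    by rewrite ler_pM // (le_trans h) // ge_min lexx ?orbT.
  by rewrite mul1r.
rewrite sumr_const card_ord -[leLHS]mulr_natr mulrAC -mulrA ler_piMr ?(ltW r0) //.
by rewrite ler_pdivrMr ?ltr0n // mul1r ler_nat.
Qed.

Lemma line_shift g p v (t : R) :
  (fun h : R => h^-1 *: ((g \o shift (p + t *: v)) (h *: v) - g (p + t *: v)))
  = (fun h : R => h^-1 *: (((fun s : R => g (p + s *: v)) \o shift t) (h *: 1)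
      - g (p + t *: v))).
Proof.
apply/funext => h /=; congr (_ *: (g _ - _)).
by rewrite [h *: 1]mulr1 scalerDl addrCA.
Qed.

Lemma is_derive_line g p v (t d : R) : is_derive (p + t *: v) v g d ->
  is_derive t 1 (fun s : R => g (p + s *: v)) d.
Proof.
case=> dg <-; split; first by rewrite /derivable -line_shift.
by rewrite /derive -line_shift.
Qed.

Lemma line_is_derive g p v (t d : R) :
  is_derive t 1 (fun s : R => g (p + s *: v)) d -> is_derive (p + t *: v) v g d.
Proof.
case=> dg <-; split; first by rewrite /derivable line_shift.
by rewrite /derive line_shift.
Qed.

Lemma MVT01 (f df : R -> R) (b : R) : 0 <= b ->
  (forall s, 0 <= s <= b -> is_derive s 1 f (df s)) ->
  exists2 s, 0 <= s <= b & f b - f 0 = df s * b.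
Proof.
move=> b0 hf; have [||s sb E] := @MVT_segment R f df 0 b b0.
- by move=> s; rewrite in_itv /= => /andP[s0 sb]; apply: hf; rewrite !ltW.
- apply: derivable_within_continuous => s; rewrite in_itv /= => sb.
  by have [] := hf s sb.
by exists s; rewrite ?subr0 // in E *; move: sb; rewrite in_itv.
Qed.

Lemma is_derive_scale_dir g x v (a d : R) :
  is_derive x v g d -> is_derive x (a *: v) g (a * d).
Proof.
move=> dg; rewrite -[x]addr0 -(scale0r (a *: v)); apply: line_is_derive.
have -> : (fun s : R => g (x + s *: (a *: v))) = (fun s => g (x + s *: v)) \o (fun s => s * a).
  by apply/funext => s /=; rewrite scalerA.
rewrite mulrC; apply: is_derive1_comp; last first.
  rewrite (_ : *%R^~ a = a *: id); last by apply/funext => s; rewrite mulrC.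
  by apply: is_derive_eq; rewrite [_ *: _]mulr1.
by apply: is_derive_line; rewrite mul0r scale0r addr0.
Qed.

(** The successive truncations lead from 0 to [h] by changing one coordinate at a time. *)
Definition trunc (k : nat) (h : 'rV[R]_n) : 'rV[R]_n :=
  \row_i if (i < k)%N then h 0 i else 0.

Lemma truncS (k : 'I_n) h : trunc k.+1 h = trunc k h + h 0 k *: 'e_k.
Proof.
apply/rowP => i; rewrite !mxE eqxx /= ltnS leq_eqVlt.
have [->|ik] := eqVneq i k; first by rewrite eqxx ltnn mulr1 add0r.
by rewrite mulr0 addr0 (_ : (nat_of_ord i == k) = false) //; apply/negbTE.
Qed.

(** Continuous partial derivatives give differentiability: telescope along the truncations of [h]
    and apply the mean value theorem to each coordinate step. *)
Lemma C1_taylor Omega g x : open Omega -> C1_on Omega g -> Omega x ->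
  forall e : R, 0 < e ->
  \forall h \near (0 : 'rV[R]_n), `|g (x + h) - g x - dot h (gradient g x)| <= e * `|h|.
Proof.
move=> oO C1 Ox e e0.
(* The n coordinate steps each contribute an error e', in total at most e; [n.+1] keeps the division
   meaningful when n = 0. *)
pose e' := e / n.+1%:R.
have e'0 : 0 < e' by rewrite divr_gt0 // ltr0n.
have : \forall y \near x, Omega y /\ forall i, `|partial i g x - partial i g y| <= e'.
  apply: filterS2 (open_nbhs_nbhs (conj oO Ox)) _ => [y Oy H|]; first by split; [exact: Oy|exact: H].
  apply: (@filter_forall _ _ (fun i y => `|partial i g x - partial i g y| <= e') (nbhs x) _) => i; have [_ /(_ i) [_ c]] := C1 x Ox.
  by move/cvgrPdist_le : c => /(_ _ e'0).
move=> /nbhs_ballP [r r0 rP].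
apply/nbhs_ballP; exists r => // h [_ hr].
have hi i : `|h 0 i| < r by have := hr 0 i; rewrite /ball /= mxE sub0r normrN.
have bx h' : (forall i, `|h' 0 i| <= `|h 0 i|) -> ball x r (x + h').
  move=> hh; split=> // a i; rewrite !ord1 /ball /= mxE opprD addrA subrr sub0r normrN.
  exact: le_lt_trans (hh i) (hi i).
have tr (k : 'I_n) : `|g (x + trunc k.+1 h) - g (x + trunc k h) - h 0 k * partial k g x|
    <= e' * `|h|.
  have bs (s : R) : 0 <= s <= 1 -> ball x r (x + trunc k h + s *: (h 0 k *: 'e_k)).
    move=> /andP[s0 s1]; rewrite -addrA; apply: bx => i; rewrite !mxE eqxx /=.
    have [->|ik] := eqVneq i k.
      rewrite ltnn add0r mulr1 normrM ler_piMl //; by rewrite ger0_norm.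
    by rewrite mulr0 mulr0 addr0; case: ifP; rewrite // normr0.
  have [//|s /andP[s0 s1]|s s01] := @MVT01 (fun s => g (x + trunc k h + s *: (h 0 k *: 'e_k)))
    (fun s => h 0 k * partial k g (x + trunc k h + s *: (h 0 k *: 'e_k))) 1.
    apply: is_derive_line; apply: is_derive_scale_dir.
    apply: derivableP; have [|Oy _] := rP _ (bs s _); first by rewrite s0.
    by have [_ /(_ k) []] := C1 _ Oy.
  rewrite scale1r scale0r addr0 mulr1 -addrA -truncS => ->.
  rewrite -mulrBr normrM mulrC ler_pM // ?normr_ge0 //.
    by rewrite distrC; have [_ ] := rP _ (bs s s01); apply.
  rewrite [leRHS]/Num.Def.normr /= mx_normrE.
  exact: (@le_bigmax _ _ _ _ (fun ij : 'I_1 * 'I_n => `|h ij.1 ij.2|) (0, k)).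
have -> : g (x + h) - g x - dot h (gradient g x) = \sum_(k < n)
   (g (x + trunc k.+1 h) - g (x + trunc k h) - h 0 k * partial k g x).
  rewrite sumrB -(big_mkord xpredT (fun k => g (x + trunc k.+1 h) - g (x + trunc k h))).
  rewrite telescope_sumr //; congr (_ - _ - _); last first.
  - by apply: eq_bigr => i _; rewrite mxE.
  - by congr g; rewrite -[LHS]addr0; congr (_ + _); apply/rowP => i; rewrite !mxE.
  - by congr g; congr (_ + _); apply/rowP => i; rewrite !mxE ltn_ord.
apply: (le_trans (ler_norm_sum _ _ _)).
apply: (@le_trans _ _ (\sum_(k < n) e' * `|h|)); first exact: ler_sum.
rewrite sumr_const card_ord -[leLHS]mulr_natr mulrAC ler_wpM2r ?normr_ge0 //.
rewrite /e' mulrAC -mulrA ler_piMr ?(ltW e0) //.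
by rewrite ler_pdivrMr ?ltr0n // mul1r ler_nat.
Qed.

Lemma C1_is_derive Omega g x v : open Omega -> C1_on Omega g -> Omega x ->
  is_derive x v g (dot v (gradient g x)).
Proof.
move=> oO C1 Ox.
have lim : (fun h : R => h^-1 *: ((g \o shift x) (h *: v) - g x)) @ 0^' -->
    dot v (gradient g x).
  apply/cvgrPdist_le => /= e e0.
  have [e' e'0 ee'] : exists2 e', 0 < e' & e' * `|v| <= e.
    exists (e / (`|v| + 1)); first by rewrite divr_gt0 // ltr_wpDl.
    by rewrite mulrAC ler_pdivrMr ?ltr_wpDl // ler_wpM2l ?(ltW e0) // lerDl.
  have /nbhs_norm0P [r r0 rP] := C1_taylor oO C1 Ox e'0.
  near=> h.
  have h0 : h != 0 by near: h; exact: nbhs_dnbhs_neq.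
  have -> : dot v (gradient g x) - h^-1 *: (g (h *: v + x) - g x) =
    - (h^-1 * (g (x + h *: v) - g x - dot (h *: v) (gradient g x))).
    by rewrite dotZl [_ *: _]mulrC (addrC x); field.
  rewrite normrN normrM normfV.
  rewrite mulrC ler_pdivrMr ?normr_gt0 //.
  apply: (@le_trans _ _ (e' * `|h *: v|)).
    apply: rP; rewrite /= normrZ.
    rewrite (@le_lt_trans _ _ (`|h| * (`|v| + 1))) // ?ler_wpM2l ?lerDl //.
    rewrite -ltr_pdivlMr ?ltr_wpDl //.
    by near: h; apply: dnbhs0_lt; rewrite divr_gt0 // ltr_wpDl.
  by rewrite normrZ mulrCA mulrC ler_wpM2r.
split; first by apply/cvg_ex; exists (dot v (gradient g x)).
exact/cvg_lim.
Unshelve. all: by end_near. Qed.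

End Calculus.

(** * Symmetry of the Hessian and derivatives along lines *)

Section SecondOrder.
Variables (R : realType) (n : nat).
Implicit Types (x y v w h p c : 'rV[R]_n) (g u : 'rV[R]_n -> R) (Omega : set 'rV[R]_n).

Lemma cvg_bigsum (I T : Type) (F : set_system T) {FF : Filter F} (r : seq I)
  (f : I -> T -> R) (l : I -> R) : (forall i, f i s @[s --> F] --> l i) ->
  \sum_(i <- r) f i s @[s --> F] --> \sum_(i <- r) l i.
Proof.
move=> fl; elim: r => [|i r IH].
  rewrite big_nil; under eq_fun do rewrite big_nil; exact: cvg_cst.
by rewrite big_cons; under eq_fun do rewrite big_cons; apply: cvgD.
Qed.

Lemma cvg_dot (T : Type) (F : set_system T) {FF : Filter F}
  (a b : T -> 'rV[R]_n) (la lb : 'rV[R]_n) :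
  (forall i, a s 0 i @[s --> F] --> la 0 i) ->
  (forall i, b s 0 i @[s --> F] --> lb 0 i) ->
  dot (a s) (b s) @[s --> F] --> dot la lb.
Proof. by move=> al bl; apply: cvg_bigsum => i; apply: cvgM. Qed.

Section RealDerive.
Variables (f g : R -> R) (t a b : R).
Hypotheses (fa : is_derive t 1 f a) (gb : is_derive t 1 g b).

Lemma is_derive_add : is_derive t 1 (fun s => f s + g s) (a + b).
Proof. exact: is_deriveD. Qed.

Lemma is_derive_sub : is_derive t 1 (fun s => f s - g s) (a - b).
Proof. exact: is_deriveB. Qed.

Lemma is_derive_mul : is_derive t 1 (fun s => f s * g s) (a * g t + f t * b).
Proof.
apply: is_derive_eq (is_deriveM fa gb) _; rewrite addrC; congr (_ + _).
exact: mulrC.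
Qed.

Lemma is_derive_mulc (k : R) : is_derive t 1 (fun s => k * f s) (k * a).
Proof. exact: is_deriveZ. Qed.

End RealDerive.

Lemma is_derive_linear (a b t : R) : is_derive t 1 (fun s => a + s * b) b.
Proof.
rewrite -[X in is_derive _ _ _ X]add0r; apply: is_derive_add.
rewrite (_ : (fun s => _) = (fun s => b * s)); last by apply/funext => s; rewrite mulrC.
by rewrite -[X in is_derive _ _ _ X]mulr1; apply: is_derive_mulc.
Qed.

Lemma is_derive_dot (t : R) (a b : R -> 'rV[R]_n) (a' b' : 'rV[R]_n) :
  (forall i, is_derive t 1 (fun s => a s 0 i) (a' 0 i)) ->
  (forall i, is_derive t 1 (fun s => b s 0 i) (b' 0 i)) ->
  is_derive t 1 (fun s => dot (a s) (b s)) (dot a' (b t) + dot (a t) b').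
Proof.
move=> ha hb.
have -> : (fun s => dot (a s) (b s)) = \sum_(i < n) ((fun s => a s 0 i) * (fun s => b s 0 i)).
  by apply/funext => s; rewrite fct_sumE.
rewrite /dot -big_split /=.
by apply: is_derive_sum => i; apply: is_derive_mul.
Qed.

Lemma is_derive_affine p v (t : R) i : is_derive t 1 (fun s : R => (p + s *: v) 0 i) (v 0 i).
Proof.
rewrite (_ : (fun s => _) = fun s => p 0 i + s * v 0 i).
  exact: is_derive_linear.
by apply/funext => s; rewrite !mxE.
Qed.

Lemma gradient_partialE u i x : gradient (partial i u) x = row i (hessian u x).
Proof. by apply/rowP => j; rewrite !mxE. Qed.

Lemma near_box x v w (P : set 'rV[R]_n) : nbhs x P ->
  exists2 s : R, 0 < s & forall a b, 0 <= a <= s -> 0 <= b <= s ->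
    P (x + a *: v + b *: w).
Proof.
case/nbhs_normP => r /= r0 rP.
pose m := `|v| + `|w| + 1.
have m0 : 0 < m by rewrite ltr_wpDl // addr_ge0.
exists (r / m); first by rewrite divr_gt0.
move=> a b /andP[a0 ar] /andP[b0 br]; apply: rP => /=.
rewrite -addrA opprD addrA subrr sub0r normrN (le_lt_trans (ler_normD _ _)) //.
rewrite !normrZ !ger0_norm //.
apply: (@le_lt_trans _ _ (r / m * (`|v| + `|w|))).
  by rewrite mulrDr lerD // ler_wpM2r.
rewrite mulrAC ltr_pdivrMr // ltr_pM2l // /m ltrDl //.
Qed.

(** Two mean value theorems: in direction i for the difference of u across s e_j, then in direction
    j for the partial derivative obtained. *)
Lemma second_difference Omega u i j x (s : R) : open Omega -> C2_on Omega u ->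
  0 <= s ->
  (forall a b, 0 <= a <= s -> 0 <= b <= s -> Omega (x + a *: 'e_i + b *: 'e_j)) ->
  exists a b, [/\ 0 <= a <= s, 0 <= b <= s &
    u (x + s *: 'e_i + s *: 'e_j) - u (x + s *: 'e_i) - (u (x + s *: 'e_j) - u x)
    = hessian u (x + a *: 'e_i + b *: 'e_j) i j * s * s].
Proof.
move=> oO [C1 C2] s0 box.
have ss : 0 <= s <= s by rewrite s0 lexx.
have zs : 0 <= (0 : R) <= s by rewrite lexx s0.
have dotE (k : 'I_n) v : dot 'e_k v = v 0 k.
  rewrite /dot (bigD1 k) //= mxE !eqxx mul1r big1 ?addr0 // => l lk.
  by rewrite mxE (negbTE lk) andbF mul0r.
have [a0 as_|a as_ E] := @MVT01 R
  (fun a => u ((x + s *: 'e_j) + a *: 'e_i) - u (x + a *: 'e_i))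
  (fun a => partial i u ((x + s *: 'e_j) + a *: 'e_i) - partial i u (x + a *: 'e_i)) s s0.
  apply: is_deriveB; apply: is_derive_line.
    have := @C1_is_derive _ _ _ u _ 'e_i oO C1 (box a0 s as_ ss).
    by rewrite dotE mxE addrAC.
  have := @C1_is_derive _ _ _ u _ 'e_i oO C1 (box a0 0 as_ zs).
  by rewrite dotE mxE scale0r addr0.
have [b0 bs|b bs E'] := @MVT01 R (fun b => partial i u ((x + a *: 'e_i) + b *: 'e_j))
  (fun b => hessian u ((x + a *: 'e_i) + b *: 'e_j) i j) s s0.
  apply: is_derive_line.
  have := @C1_is_derive _ _ _ (partial i u) _ 'e_j oO (C2 i) (box a b0 as_ bs).
  by rewrite dotE gradient_partialE mxE.
exists a, b; split=> //; rewrite -E' scale0r addr0.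
move: E; rewrite !scale0r !addr0 (addrAC x (s *: 'e_j)) => ->.
by rewrite (addrAC x (s *: 'e_j)).
Qed.

Lemma cvg_gradient Omega u x i : C1_on Omega u -> Omega x ->
  gradient u y 0 i @[y --> x] --> gradient u x 0 i.
Proof.
move=> C1 Ox; have [_ /(_ i) [_ c]] := C1 x Ox.
have gE y : gradient u y 0 i = partial i u y by rewrite mxE.
rewrite gE (_ : (fun y => gradient u y 0 i) = partial i u); first exact: c.
exact/funext.
Qed.

Lemma cvg_hessian Omega u x i j : C2_on Omega u -> Omega x ->
  hessian u y i j @[y --> x] --> hessian u x i j.
Proof.
move=> C2 Ox; have [_ /(_ j) [_ c]] := C2.2 i x Ox.
have hE y : hessian u y i j = partial j (partial i u) y by rewrite mxE.
have c' : hessian u y i j @[y --> x] --> partial j (partial i u) x.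
  rewrite (_ : (fun y => hessian u y i j) = partial j (partial i u)); first exact: c.
  exact/funext.
exact: (eq_rect_r (fun l : R => hessian u y i j @[y --> x] --> l) c' (hE x)).
Qed.

(** The contradiction that ends the symmetry proof: equality of the second differences forces z1 =
    z2, and p, q both lie within |d| / 3 of this value, although they differ by d. *)
Lemma equal_quotients (s d D D' z1 z2 p q : R) : 0 < s -> d != 0 ->
  D = z1 * s * s -> D' = z2 * s * s -> D = D' ->
  `|p - z1| < `|d| / 3 -> `|q - z2| < `|d| / 3 -> q - p = d -> false.
Proof.
move=> s0 d0 E1 E2 E3 k1 k2 qp.
have EE : z2 * s * s = z1 * s * s by rewrite -E1 -E2 E3.
have {}EE : z2 = z1 by apply: (mulIf (lt0r_neq0 s0)); apply: (mulIf (lt0r_neq0 s0)).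
have := ler_normD (q - z1) (- (p - z1)).
rewrite normrN opprB addrA subrK qp; rewrite EE in k2.
have : 0 < `|d| by rewrite normr_gt0.
by move: (`|d|) k1 k2 => d' *; lra.
Qed.

(** The second difference over a small square is symmetric in i and j, and by [second_difference] it
    represents either mixed derivative at a point near x. *)
Lemma hessian_sym Omega u x : open Omega -> C2_on Omega u -> Omega x ->
  (hessian u x)^T = hessian u x.
Proof.
move=> oO C2 Ox; apply/matrixP => i j; rewrite mxE.
apply/eqP; rewrite -subr_eq0; apply: contraT.
move E0 : (_ - _) => d ne; have d0 : 0 < `|d| / 3 by rewrite divr_gt0 ?normr_gt0.
have cont (k l : 'I_n) : \forall y \near x, `|hessian u x k l - hessian u y k l| < `|d| / 3.
  by have /cvgrPdist_lt /(_ _ d0) := @cvg_hessian Omega u x k l C2 Ox.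
have H : \forall y \near x, [/\ Omega y, `|hessian u x i j - hessian u y i j| < `|d| / 3
    & `|hessian u x j i - hessian u y j i| < `|d| / 3].
  by near=> y; split; near: y; [exact: open_nbhs_nbhs| exact: cont| exact: cont].
have [s s0 sP] := near_box 'e_i 'e_j H.
have [|a [b [ha hb E]]] := @second_difference Omega u i j x s oO C2 (ltW s0).
  by move=> a b ha hb; have [] := sP a b ha hb.
have [|a' [b' [ha' hb' E']]] := @second_difference Omega u j i x s oO C2 (ltW s0).
  by move=> b' a' hb' ha'; rewrite addrAC; have [] := sP a' b' ha' hb'.
have e : x + b' *: 'e_i + a' *: 'e_j = x + a' *: 'e_j + b' *: 'e_i by rewrite addrAC.
have e' : x + s *: 'e_j + s *: 'e_i = x + s *: 'e_i + s *: 'e_j by rewrite addrAC.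
have [_ h1 _] := sP _ _ ha hb.
have [_ _ h2] := sP _ _ hb' ha'.
rewrite e in h2; rewrite e' in E'.
by apply: (@equal_quotients s d) s0 ne E E' _ h1 h2 E0; ring.
Unshelve. all: by end_near. Qed.

Variables (Omega : set 'rV[R]_n) (u : 'rV[R]_n -> R).
Hypotheses (oO : open Omega) (C2 : C2_on Omega u).

Lemma derive_u_line p v (t : R) : Omega (p + t *: v) ->
  is_derive t 1 (fun s : R => u (p + s *: v)) (dot v (gradient u (p + t *: v))).
Proof. by move=> O; apply: is_derive_line; apply: C1_is_derive oO C2.1 O. Qed.

Lemma derive_gradient_line p v (t : R) i : Omega (p + t *: v) ->
  is_derive t 1 (fun s : R => gradient u (p + s *: v) 0 i)
    ((v *m hessian u (p + t *: v)) 0 i).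
Proof.
move=> O; have := @C1_is_derive _ _ _ (partial i u) _ v oO (C2.2 i) O.
rewrite gradient_partialE => /is_derive_line.
rewrite (_ : dot _ _ = (v *m hessian u (p + t *: v)) 0 i); last first.
  rewrite -[in RHS](hessian_sym oO C2 O) mxE; apply: eq_bigr => j _.
  by rewrite !mxE.
rewrite (_ : (fun s => partial i u (p + s *: v)) = (fun s => gradient u (p + s *: v) 0 i)) //.
by apply/funext => s; rewrite mxE.
Qed.

(* Half the derivative at t = 0 of (1 + t)^-2 u (c + (1 + t) (x - c)). *)
Definition W c x := - u x + 2^-1 * dot (x - c) (gradient u x).

(** The differential of [W u c] at [x] in direction [v]. It exists for u of class C2 because [W]
    involves only first derivatives. *)
Definition dW c x v := 2^-1 * (dot (x - c) (v *m hessian u x) - dot v (gradient u x)).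

Lemma derive_W_line c p v (t : R) : Omega (p + t *: v) ->
  is_derive t 1 (fun s : R => W c (p + s *: v)) (dW c (p + t *: v) v).
Proof.
move=> O; have hu := derive_u_line O.
have hd : is_derive t 1 (fun s => dot (p + s *: v - c) (gradient u (p + s *: v)))
   (dot v (gradient u (p + t *: v)) + dot (p + t *: v - c) (v *m hessian u (p + t *: v))).
  apply: is_derive_dot => i; last exact: derive_gradient_line.
  have := is_derive_affine (p - c) v t i.
  by under eq_fun do rewrite addrAC.
apply: is_derive_eq (is_derive_add (is_deriveN hu) (is_derive_mulc hd 2^-1)) _.
by rewrite /dW; field.
Qed.

End SecondOrder.

(** * One-variable maximum conditions and elementary inequalities *)

Section OneDim.
Variable R : realType.
Implicit Types f df : R -> R.

Lemma local_max_derive0 f (d r : R) : 0 < r -> is_derive (0 : R) 1 f d ->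
  (forall s : R, `|s| < r -> derivable f s 1) ->
  (forall s : R, `|s| < r -> f s <= f 0) -> d = 0.
Proof.
move=> r0 fd fdr fmax.
have rE (t : R) : t \in `](- r), r[ -> `|t| < r by rewrite in_itv /= ltr_norml.
have rr : - r <= r by lra.
have r0i : 0 \in `](- r), r[ by rewrite in_itv /= oppr_lt0 r0.
have [_ <-] := fd.
by have [_ ->] := derive1_at_max rr (fun t tr => fdr t (rE t tr)) r0i (fun t tr => fmax t (rE t tr)).
Qed.

(** If d > 0 then df > 0 just to the right of 0, because df 0 = 0, and the mean value theorem makes
    f increase there. *)
Lemma second_order_max f df (d r : R) : 0 < r ->
  (forall s : R, `|s| < r -> is_derive s 1 f (df s)) -> is_derive (0 : R) 1 df d ->
  (forall s : R, `|s| < r -> f s <= f 0) -> d <= 0.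
Proof.
move=> r0 fd dfd fmax.
have df0 : df 0 = 0.
  apply: (@local_max_derive0 f _ r) => //; first by apply: fd; rewrite normr0.
  by move=> s /fd [].
rewrite leNgt; apply/negP => d0.
have [dfc dE] := dfd; rewrite -dE in d0.
have : \forall h \near 0^', 0 < h^-1 *: ((df \o shift 0) (h *: 1) - df 0).
  exact: (@cvgr_gt _ _ _ _ _ ('D_1 df 0) dfc 0 d0).
rewrite near_withinE => /nbhs_norm0P [e /= e0 eP].
pose m := Num.min (e / 2) (r / 2).
have m0 : 0 < m by rewrite lt_min !divr_gt0.
have me : m < e by rewrite gt_min; apply/orP; left; lra.
have mr : m < r by rewrite gt_min; apply/orP; right; lra.
have [||s sm E] := @MVT R f df 0 m m0.
- move=> s; rewrite in_itv /= => /andP[s0 sm]; apply: fd.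
  by rewrite gtr0_norm // (lt_trans sm).
- apply: derivable_within_continuous => s; rewrite in_itv /= => /andP[s0 sm].
  by have [] : is_derive s 1 f (df s) by apply: fd; rewrite ger0_norm // (le_lt_trans sm).
move: sm; rewrite in_itv /= => /andP[s0 sm].
have := fmax m; rewrite gtr0_norm // => /(_ mr).
rewrite -subr_le0 E subr0 pmulr_lle0 // leNgt => /negP; apply.
have := eP s; rewrite /= gtr0_norm // => /(_ (lt_trans sm me)) /(_ (lt0r_neq0 s0)).
by rewrite df0 subr0 addr0 [s *: 1]mulr1 pmulr_rgt0 // invr_gt0.
Qed.

(** Square 1 - t / 2 <= exp (- t / 2); the bound t <= 2 makes the left side nonnegative. *)
Lemma expR_quadratic_lower (t : R) : t <= 2 -> 1 - t + t ^+ 2 / 4 <= expR (- t).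
Proof.
move=> t2.
have -> : - t = - t / 2 + - t / 2 by field.
rewrite expRD; have h := expR_ge1Dx (- t / 2).
have h0 : 0 <= 1 + - t / 2 by lra.
have : (1 + - t / 2) * (1 + - t / 2) <= expR (- t / 2) * expR (- t / 2) by rewrite ler_pM.
by apply: le_trans; rewrite le_eqVlt; apply/orP; left; apply/eqP; field.
Qed.

(** The increment a - c has no definite sign, but a - c - 2 e <= 0. Splitting off 2 e allows the
    lower slope bound eta on the nonpositive part and the upper bound K on the rest. *)
Lemma slope_bound (q eta K a c e : R) : 0 <= e -> eta <= q -> q <= K ->
  a <= c + 2 * e -> q * (a - c) <= eta * (a - c - 2 * e) + 2 * e * K.
Proof.
move=> e0 etaq qK ac.
have h1 : (q - eta) * (a - c - 2 * e) <= 0 by rewrite mulr_ge0_le0 ?subr_ge0 //; lra.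
have h2 : 2 * e * q <= 2 * e * K by rewrite ler_wpM2l // mulr_ge0.
by lra.
Qed.

End OneDim.

(** * Compactness of Euclidean balls and continuity of dilations *)

Section Topology.
Variables (R : realType) (n : nat).
Implicit Types (x y v c : 'rV[R]_n).

Lemma cvg_coord (T : Type) (F : set_system T) {FF : Filter F} (f : T -> 'rV[R]_n) (l : 'rV[R]_n) i :
  f s @[s --> F] --> l -> f s 0 i @[s --> F] --> l 0 i.
Proof. by move=> fl; apply: (cvg_comp _ (fun y : 'rV[R]_n => y 0 i) fl); exact: coord_continuous. Qed.

Lemma dot_ball_compact x (r : R) : compact [set y | dot (y - x) (y - x) <= r].
Proof.
have cont : continuous (fun y => dot (y - x) (y - x)).
  move=> y; have h i : (z - x) 0 i @[z --> y] --> (y - x) 0 i.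
    apply: (@cvg_coord _ (nbhs y) _ (fun z => z - x)).
    by apply: cvgB; [exact: cvg_id|exact: cvg_cst].
  exact: (@cvg_dot R n _ (nbhs y) _ (fun y => y - x) (fun y => y - x)).
apply: bounded_closed_compact; last first.
  rewrite (_ : [set _ | _] = (fun y => dot (y - x) (y - x)) @^-1` [set z | z <= r]) //.
  by apply: closed_comp => [y _|]; [exact: cont|exact: closed_le].
exists (`|x| + `|r| + 1); split; first exact: num_real.
move=> M hM y /= yr; apply: le_trans (ltW hM).
rewrite -[y](subrK x) addrC -addrA (le_trans (ler_normD _ _)) // lerD2l.
rewrite [leLHS]/Num.Def.normr /= mx_normrE bigmax_le ?addr_ge0 // => -[i j] _ /=.
rewrite ord1; have : (y - x) 0 j ^+ 2 <= `|r|.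
  apply: (le_trans _ (le_trans yr (ler_norm r))).
  rewrite /dot (bigD1 j) //= -expr2 lerDl.
  by apply: sumr_ge0 => k _; rewrite -expr2 sqr_ge0.
rewrite -(real_normK (num_real ((y - x) 0 j))).
move: (normr_ge0 ((y - x) 0 j)) (normr_ge0 r).
by move: (`|(y - x) 0 j|) (`|r|) => a b *; nra.
Qed.

Lemma cvg_scaling c x :
  p.2 + p.1 *: (p.2 - c) @[p --> ((0 : R), x)] --> x.
Proof.
rewrite -[X in _ --> X]addr0 -(scale0r (x - c)); apply: cvgD; first exact: cvg_snd.
apply: cvgZ; first exact: cvg_fst.
by apply: cvgB; [exact: cvg_snd|exact: cvg_cst].
Qed.

Lemma norm_sqr_le_dot v : `|v| ^+ 2 <= dot v v.
Proof.
rewrite -[leRHS]sqr_sqrtr ?dot_ge0 // ler_sqr ?nnegrE ?sqrtr_ge0 //.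
rewrite [leLHS]/Num.Def.normr /= mx_normrE bigmax_le ?sqrtr_ge0 // => -[i j] _ /=.
rewrite ord1 -sqrtr_sqr ler_sqrt ?dot_ge0 //.
rewrite /dot (bigD1 j) //= -expr2 lerDl.
by apply: sumr_ge0 => k _; rewrite -expr2 sqr_ge0.
Qed.

Lemma coord_le_norm v i : `|v 0 i| <= `|v|.
Proof.
rewrite [leRHS]/Num.Def.normr /= mx_normrE.
exact: (@le_bigmax _ _ _ _ (fun ij : 'I_1 * 'I_n => `|v ij.1 ij.2|) (0, i)).
Qed.

End Topology.

(** * Comparison of u with its rescalings at a touching point *)

Section Touching.
Variables (R : realType) (n : nat) (Omega : set 'rV[R]_n) (u : 'rV[R]_n -> R).
Hypotheses (oO : open Omega) (C2 : C2_on Omega u).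
Implicit Types (x y v w p c l : 'rV[R]_n) (B : 'M[R]_n).

Lemma cvg_at x (T : Type) (F : set_system T) {FF : Filter F} (p : T -> 'rV[R]_n)
  (g : 'rV[R]_n -> R) : {for x, continuous g} ->
  p s @[s --> F] --> x -> g (p s) @[s --> F] --> g x.
Proof. by move=> gc px; apply: (cvg_comp p g px). Qed.

Lemma cvg_pointwise_eq (T : Type) (F : set_system T) (f g : T -> R) (a b : R) :
  f =1 g -> a = b -> g s @[s --> F] --> b -> f s @[s --> F] --> a.
Proof. by move=> /funext -> ->. Qed.

Lemma cvg_mulmx_hessian x v (T : Type) (F : set_system T) {FF : Filter F}
  (p w : T -> 'rV[R]_n) i : Omega x ->
  p s @[s --> F] --> x -> w s @[s --> F] --> v ->
  (w s *m hessian u (p s)) 0 i @[s --> F] --> (v *m hessian u x) 0 i.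
Proof.
move=> Ox px wv.
apply: (@cvg_pointwise_eq _ _ _ (fun s => \sum_j w s 0 j * hessian u (p s) j i) _
   (\sum_j v 0 j * hessian u x j i)) => [s||]; [by rewrite mxE|by rewrite mxE|].
apply: cvg_bigsum => j; apply: cvgM; first exact: cvg_coord.
by apply: (cvg_at (g := fun y => hessian u y j i)) px; apply: cvg_hessian C2 Ox.
Qed.

Lemma near_Omega_scaling c x : Omega x ->
  \forall p \near ((0 : R), x), Omega (p.2 + p.1 *: (p.2 - c)).
Proof.
move=> Ox; apply: (@cvg_scaling R n c x); exact: open_nbhs_nbhs.
Qed.

Lemma near_snd x (P : set 'rV[R]_n) : (\forall y \near x, P y) ->
  \forall p \near ((0 : R), x), P p.2.
Proof. by move=> hP; exists (setT, P) => [|[t y] []] //; split=> //; exact: filterT. Qed.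

Lemma near_fst x (P : set R) : (\forall t \near (0 : R), P t) ->
  \forall p \near ((0 : R), x), P p.1.
Proof. by move=> hP; exists (P, setT) => [|[t y] []] //; split=> //; exact: filterT. Qed.

(** Makes a property hold for all parameters from 0 to t, as the mean value theorem in the dilation
    parameter requires. *)
Lemma near_segment (x : 'rV[R]_n) (P : set (R * 'rV[R]_n)) :
  (\forall p \near ((0 : R), x), P p) ->
  \forall p \near ((0 : R), x), forall s, 0 <= s <= p.1 -> P (s, p.2).
Proof.
case=> -[U V] /= [/nbhs_norm0P [r /= r0 rU] Vx] UVP.
exists ([set t | `|t| < r], V) => /=.
  split=> //; apply: (filterS _ (nbhsx_ballx (0 : R) r r0)) => t.
  by rewrite /ball /= sub0r normrN.
move=> [t y] /= [tr Vy] s /andP[s0 st]; apply: UVP; split=> //=; apply: rU => /=.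
rewrite ger0_norm // (le_lt_trans st) // (le_lt_trans (ler_norm t)) //.
Qed.

Lemma near_line x v (P : set 'rV[R]_n) : nbhs x P ->
  exists2 m : R, 0 < m & forall s, `|s| < m -> P (x + s *: v).
Proof.
case/nbhs_normP => r /= r0 rP.
have v0 : 0 < `|v| + 1 by rewrite ltr_wpDl.
exists (r / (`|v| + 1)) => [|s sm]; first by rewrite divr_gt0.
apply: rP => /=; rewrite opprD addrA subrr sub0r normrN normrZ.
apply: (@le_lt_trans _ _ (`|s| * (`|v| + 1))); first by rewrite ler_wpM2l ?lerDl.
by rewrite -ltr_pdivlMr.
Qed.

Lemma derive_dot_gradient w p v (t : R) : Omega (p + t *: v) ->
  is_derive t 1 (fun s : R => dot w (gradient u (p + s *: v)))
    (dot w (v *m hessian u (p + t *: v))).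
Proof.
move=> O; rewrite -[X in is_derive _ _ _ X]add0r -(dot0l (gradient u (p + t *: v))).
apply: is_derive_dot => i; last exact: (derive_gradient_line oO C2).
by rewrite mxE; exact: is_derive_cst.
Qed.

(** Mean value theorem along the dilation, with [dW] continuous. The bound is uniform in the base
    point, since the touching point varies with t; the centre c of the dilation and the centre c' of
    the function are independent. *)
Lemma W_increment c c' x (e : R) : Omega x -> 0 < e ->
  \forall p \near ((0 : R), x), 0 <= p.1 ->
    p.1 * (dW u c' x (x - c) - e) <= W u c' (p.2 + p.1 *: (p.2 - c)) - W u c' p.2.
Proof.
move=> Ox e0.
have cdW : dW u c' (p.2 + p.1 *: (p.2 - c)) (p.2 - c) @[p --> ((0 : R), x)]
    --> dW u c' x (x - c).
  have cy : p.2 - c @[p --> ((0 : R), x)] --> x - c.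
    by apply: cvgB; [exact: cvg_snd|exact: cvg_cst].
  have cT := @cvg_scaling R n c x.
  apply: cvgM; first exact: cvg_cst.
  apply: cvgB; apply: cvg_dot => i.
  - by apply: cvg_coord; apply: cvgB cT (cvg_cst _).
  - exact: cvg_mulmx_hessian.
  - exact: cvg_coord.
  - apply: (cvg_at (g := fun y => gradient u y 0 i)) cT.
    exact: cvg_gradient C2.1 Ox.
have H : \forall p \near ((0 : R), x), Omega (p.2 + p.1 *: (p.2 - c)) /\
    dW u c' x (x - c) - e < dW u c' (p.2 + p.1 *: (p.2 - c)) (p.2 - c).
  near=> p; split; near: p; first exact: near_Omega_scaling.
  by apply: (cvgr_gt _ cdW); rewrite ltrBlDr ltrDl.
apply: filterS (near_segment H) => -[t y] /= hty t0.
have [s s0|s st E] := @MVT01 R (fun s => W u c' (y + s *: (y - c)))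
  (fun s => dW u c' (y + s *: (y - c)) (y - c)) t t0.
  by apply: (derive_W_line oO C2); have [] := hty s s0.
move: E; rewrite scale0r addr0 => ->.
rewrite mulrC ler_wpM2r //; apply/ltW.
by have [] := hty s st.
Unshelve. all: by end_near. Qed.

Variables (c l x0 : 'rV[R]_n) (B : 'M[R]_n).
Hypothesis Ox0 : Omega x0.

(** The test polynomial with slope [l] and Hessian [B]; the slack [d] turns a touching up to o(|y -
    x0|^2) into an inequality near x0. *)
Let psi (d : R) y := dot l (y - x0) + 2^-1 * dot ((y - x0) *m B) (y - x0)
  + d * dot (y - x0) (y - x0).

Hypothesis touch : forall d, 0 < d ->
  \forall y \near x0, W u c y <= W u c x0 + psi d y.

Lemma psi_line (d : R) y v (s : R) : psi d (y + s *: v) = psi d y +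
  s * (dot l v + 2^-1 * (dot (v *m B) (y - x0) + dot ((y - x0) *m B) v)
      + 2 * d * dot (y - x0) v)
  + s * s * (2^-1 * dot (v *m B) v + d * dot v v).
Proof.
rewrite /psi (addrAC y); move: (y - x0) => z.
by rewrite mulmxDl -scalemxAl !(dotDl, dotDr, dotZl, dotZr) (dotC v z); field.
Qed.

Lemma cvg_psi (d : R) x (T : Type) (F : set_system T) {FF : Filter F} (q : T -> 'rV[R]_n) :
  q s @[s --> F] --> x -> psi d (q s) @[s --> F] --> psi d x.
Proof.
move=> qx.
have zx : q s - x0 @[s --> F] --> x - x0 by apply: cvgB qx (cvg_cst _).
have zi i : (q s - x0) 0 i @[s --> F] --> (x - x0) 0 i by exact: cvg_coord.
have zB i : ((q s - x0) *m B) 0 i @[s --> F] --> ((x - x0) *m B) 0 i.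
  apply: (@cvg_pointwise_eq _ _ _ (fun s => \sum_j (q s - x0) 0 j * B j i) _
    (\sum_j (x - x0) 0 j * B j i)) => [s||]; [by rewrite mxE|by rewrite mxE|].
  apply: cvg_bigsum => j.
  exact: cvgM (zi j) (cvg_cst (B j i)).
apply: cvgD; first apply: cvgD.
- by apply: cvg_dot => // i; exact: cvg_cst.
- by apply: cvgM; [exact: cvg_cst|exact: cvg_dot].
- by apply: cvgM; [exact: cvg_cst|exact: cvg_dot].
Qed.

(** On each line through x0 the difference between W and the test polynomial has a local maximum at
    x0; any slack will do, here 1. *)
Lemma touching_first_order v : dW u c x0 v = dot l v.
Proof.
pose P y := W u c y <= W u c x0 + psi 1 y /\ Omega y.
have nP : nbhs x0 P by apply: filterI (touch ltr01) (open_nbhs_nbhs (conj oO Ox0)).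
have [m m0 mP] := near_line v nP.
pose C := 2^-1 * dot (v *m B) v + 1 * dot v v.
pose f (s : R) := W u c (x0 + s *: v) - (s * dot l v + C * (s * s)).
have fd (s : R) : `|s| < m ->
    is_derive s 1 f (dW u c (x0 + s *: v) v - (1 * dot l v + s * 0 + C * (1 * s + s * 1))).
  move=> /mP [_ Os]; apply: is_derive_sub; first exact: (derive_W_line oO C2).
  apply: is_derive_add; first exact: (is_derive_mul (is_derive_id s 1) (is_derive_cst (dot l v) s 1)).
  by apply: is_derive_mulc; apply: is_derive_mul; exact: is_derive_id.
have := @local_max_derive0 R f _ (m) m0 (fd 0 _).
rewrite normr0 => /(_ m0).
rewrite scale0r !(mul0r, mulr0, addr0, mul1r) => h.
apply/eqP; rewrite -subr_eq0; apply/eqP; apply: h.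
  by move=> s /fd [].
move=> s /mP [Ps _]; rewrite /f scale0r addr0 mul0r mul0r mulr0 addr0 subr0.
rewrite lerBlDr; apply: (le_trans Ps).
rewrite psi_line /psi /C subrr mul0mx !(dot0l, dot0r) !mulr0 !addr0 add0r.
by rewrite lerD2l mulr0 addr0 (mulrC (s * s)).
Qed.

(* K t compares u with its rescaling about c; K t / (2 t) converges to
   W - psi uniformly near x0, and W - psi has a strict maximum at x0. *)
Lemma touching (d : R) (P : set (R * 'rV[R]_n)) : 0 < d ->
  (\forall p \near ((0 : R), x0), P p) ->
  exists t y, [/\ 0 < t, P (t, y) & forall v,
    dot (v *m hessian u (y + t *: (y - c))) v <=
    dot (v *m hessian u y) v + 2 * t * (dot (v *m B) v + d * dot v v)].
Proof.
move=> d0 nP; pose d4 := d / 4; have d40 : 0 < d4 by rewrite divr_gt0.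
(* Near x0 the function W lies below W(x0) plus the polynomial with slack [d4]. Using slack [d2]
   makes the maximum strict, with a gap d4 |y - x0|^2, and 2 d2 = d is the term allowed in the
   conclusion. *)
pose d2 := d4 + d4.
(* The difference of the rescaled and the original function, minus 2 t psi, all multiplied by (1 +
   t)^2 to avoid inverses; [G] is its derivative in t. *)
pose K (t : R) y := u (y + t *: (y - c)) - (1 + t) * (1 + t) * u y
   - 2 * t * ((1 + t) * (1 + t)) * psi d2 y.
pose G (t : R) y := dot (y - c) (gradient u (y + t *: (y - c)))
   - 2 * (1 + t) * u y
   - 2 * ((1 + t) * (1 + t) + t * (2 * (1 + t))) * psi d2 y.
have G0 y : G 0 y = 2 * (W u c y - psi d2 y).
  by rewrite /G /W scale0r addr0; field.
have K0 y : K 0 y = 0 by rewrite /K scale0r addr0 addr0 !mul1r mulr0 !mul0r subrr subr0.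
have dK y (t : R) : Omega (y + t *: (y - c)) ->
    is_derive t 1 (fun t => K t y) (G t y).
  move=> Ot.
  have d1 (s : R) : is_derive s 1 (fun s => 1 + s) 1.
    have := is_derive_linear 1 1 s.
    by rewrite (_ : (fun s => 1 + s * 1) = (fun s => 1 + s)) //; apply/funext => ?; rewrite mulr1.
  have d2' : is_derive t 1 (fun s => (1 + s) * (1 + s)) (1 * (1 + t) + (1 + t) * 1).
    exact: is_derive_mul.
  have did := @is_derive_id R R t 1.
  have du := derive_u_line oO C2 Ot.
  have e1 := is_derive_mul d2' (is_derive_cst (u y) t 1).
  have e2 := is_derive_mul (is_derive_mul (is_derive_mulc did 2) d2') (is_derive_cst (psi d2 y) t 1).
  apply: is_derive_eq (is_derive_sub (is_derive_sub du e1) e2) _.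
  by rewrite /G /cst; ring.
case: nP => -[U V] /= [U0 Vx] UVP.
have [r r0 rP] : exists2 r, 0 < r & forall y, dot (y - x0) (y - x0) <= r ->
    [/\ Omega y, W u c y <= W u c x0 + psi d4 y & V y].
  apply/nbhs_dotP; near=> y; split; near: y; [exact: open_nbhs_nbhs|exact: touch|exact: Vx].
(* On the sphere 2 (W - psi) is smaller than at x0 by at least 2 d4 r, while replacing K t / t by G
   0 costs at most e at each of the two points. *)
pose e := d4 * r / 2; have e0 : 0 < e by rewrite divr_gt0 // mulr_gt0.
pose Q (p : R * 'rV[R]_n) := Omega (p.2 + p.1 *: (p.2 - c)) /\ `|G p.1 p.2 - G 0 p.2| < e.
have Qnear x : Omega x -> \forall p \near ((0 : R), x), Q p.
  move=> Ox.
  have cGen (tau : R * 'rV[R]_n -> R) : tau p @[p --> ((0 : R), x)] --> (0 : R) ->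
      G (tau p) p.2 @[p --> ((0 : R), x)] --> G 0 x.
    move=> ctau.
    have c2 : p.2 @[p --> ((0 : R), x)] --> x by exact: cvg_snd.
    have c2c : p.2 - c @[p --> ((0 : R), x)] --> x - c by apply: cvgB c2 (cvg_cst _).
    have cT : p.2 + tau p *: (p.2 - c) @[p --> ((0 : R), x)] --> x.
      by rewrite -[X in _ --> X]addr0 -(scale0r (x - c)); apply: cvgD c2 (cvgZ ctau c2c).
    have c1 : 1 + tau p @[p --> ((0 : R), x)] --> 1 + (0 : R) by apply: cvgD (cvg_cst _) ctau.
    apply: cvgB; first apply: cvgB.
    - apply: cvg_dot => i; first exact: cvg_coord.
      apply: (cvg_at (g := fun y => gradient u y 0 i)); last by rewrite scale0r addr0.
      by rewrite scale0r addr0; exact: cvg_gradient C2.1 Ox.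
    - apply: cvgM; first by apply: cvgM c1; exact: cvg_cst.
      by apply: cvg_at c2; have [] := C2.1 x Ox.
    - apply: cvgM; last exact: cvg_psi.
      apply: cvgM; first exact: cvg_cst.
      apply: cvgD; first exact: cvgM.
      by apply: cvgM => //; apply: cvgM => //; exact: cvg_cst.
  have cG : G p.1 p.2 - G 0 p.2 @[p --> ((0 : R), x)] --> (0 : R).
    rewrite -[X in _ --> X](subrr (G 0 x)); apply: cvgB; apply: cGen; first exact: cvg_fst.
    exact: cvg_cst.
  near=> p; split; near: p; first exact: near_Omega_scaling.
  by have /cvgr0Pnorm_lt /(_ _ e0) := cG.
(* One t serves the whole closed ball: the local statements [Qnear] are glued by compactness. *)
have : \forall t \near (0 : R), forall y, dot (y - x0) (y - x0) <= r ->
    forall s, 0 <= s <= t -> Q (s, y).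
  have /compact_near_coveringP cK := @dot_ball_compact R n x0 r.
  apply: (cK R (nbhs (0 : R)) (fun t y => forall s, 0 <= s <= t -> Q (s, y)) _) => x /= xr.
  have [Ox _ _] := rP x xr.
  have [[U' V'] /= [U'0 V'x] UVP'] := near_segment (Qnear x Ox).
  by exists (V', U') => // -[y t] /= [V'y U't]; apply: (UVP' (t, y)).
move=> /(filterI U0) /nbhs_norm0P [t1 /= t10 t1P].
pose t := t1 / 2.
have t0 : 0 < t by rewrite divr_gt0.
have [Ut tQ] : U t /\ forall y, dot (y - x0) (y - x0) <= r -> forall s, 0 <= s <= t -> Q (s, y).
  by apply: t1P => /=; rewrite gtr0_norm // /t; lra.
have KG y : dot (y - x0) (y - x0) <= r -> `|K t y - t * G 0 y| <= t * e.
  move=> yr; have [s st|s st] := @MVT01 R (fun t => K t y) (fun t => G t y) t (ltW t0).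
    by apply: dK; have [] := tQ y yr s st.
  rewrite K0 subr0 => ->; have [_ /= h] := tQ y yr s st.
  by rewrite mulrC -mulrBr normrM gtr0_norm // ler_wpM2l ?(ltW t0) // ltW.
have tt : 0 <= t <= t by rewrite lexx ltW.
have [|||y yK ymax] := @compact_EVT_max 'rV[R]_n R (K t) [set y | dot (y - x0) (y - x0) <= r].
- by exists x0 => /=; rewrite subrr dot0l ltW.
- exact: dot_ball_compact.
- apply: continuous_in_subspaceT => y /[!inE] /= yr.
  have [Oy _ _] := rP y yr; have [OTy _] := tQ y yr t tt.
  have c2 : z @[z --> y] --> y by exact: cvg_id.
  have cT : z + t *: (z - c) @[z --> y] --> y + t *: (y - c).
    by apply: cvgD c2 (cvgZ (cvg_cst t) (cvgB c2 (cvg_cst c))).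
  have k1 : u (z + t *: (z - c)) @[z --> y] --> u (y + t *: (y - c)).
    by apply: cvg_at cT; have [] := C2.1 _ OTy.
  have k2 : u z @[z --> y] --> u y by have [] := C2.1 y Oy.
  have k3 : psi d2 z @[z --> y] --> psi d2 y by exact: (@cvg_psi d2 y _ (nbhs y) _ id).
  exact: (cvgB (cvgB k1 (cvgM (cvg_cst ((1 + t) * (1 + t))) k2))
    (cvgM (cvg_cst (2 * t * ((1 + t) * (1 + t)))) k3)).
rewrite inE /= in yK.
have {}ymax z : dot (z - x0) (z - x0) <= r -> K t z <= K t y.
  by move=> zr; apply: ymax; rewrite inE.
have x0r : dot (x0 - x0) (x0 - x0) <= r by rewrite subrr dot0l ltW.
have psi0 : psi d2 x0 = 0 by rewrite /psi subrr !(mul0mx, dot0l, dot0r, mulr0, addr0).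
(* The maximum point is interior: on the sphere K t would lie strictly below K t x0. *)
have yr : dot (y - x0) (y - x0) < r.
  rewrite lt_neqAle yK andbT; apply/eqP => yrE.
  have := ymax x0 x0r; have := KG x0 x0r; have := KG y yK.
  rewrite !G0 psi0 subr0 !ler_distl => /andP[_ h1] /andP[h2 _] h3.
  have [_ h4 _] := rP y yK.
  have h5 : psi d2 y = psi d4 y + d4 * r.
    by rewrite /psi /d2 mulrDl yrE; ring.
  have h6 : t * (2 * (W u c y - psi d2 y)) <= t * (2 * (W u c x0 - d4 * r)).
    by rewrite ler_wpM2l ?(ltW t0) // h5; lra.
  have h7 : 0 < t * (d4 * r) by rewrite !mulr_gt0.
  have h8 : t * e = t * (d4 * r) / 2 by rewrite /e; field.
  have h9 : t * (2 * (W u c x0 - d4 * r)) = t * (2 * W u c x0) - 2 * (t * (d4 * r)) by ring.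
  by move: h1 h2 h3 h6; rewrite h9 h8; move: (t * (d4 * r)) (t * (2 * W u c x0)) h7 => z1 z2 *; lra.
exists t, y; split=> //.
  by apply: (UVP (t, y)); split=> //=; have [] := rP y yK.
move=> v.
have nball : nbhs y [set z | dot (z - x0) (z - x0) < r].
  have cz : z - x0 @[z --> y] --> y - x0 by exact: cvgB cvg_id (cvg_cst x0).
  have cd : dot (z - x0) (z - x0) @[z --> y] --> dot (y - x0) (y - x0).
    by apply: (@cvg_dot R n _ (nbhs y) _ (fun z => z - x0) (fun z => z - x0)) => i; exact: cvg_coord.
  exact: cvgr_lt _ cd r yr.
have [m m0 mP] := near_line v nball.
(* Moving y by s v moves the dilated point by s (1 + t) v, so the second derivative at that point
   carries the factor (1 + t)^2 of the other terms and the factor cancels. *)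
have TE (s : R) : y + s *: v + t *: (y + s *: v - c) = y + t *: (y - c) + s *: ((1 + t) *: v).
  by apply/rowP => i; rewrite !mxE; ring.
have mO (s : R) : `|s| < m -> Omega (y + t *: (y - c) + s *: ((1 + t) *: v)) /\ Omega (y + s *: v).
  move=> /mP /ltW ys; split; last by have [] := rP _ ys.
  by rewrite -TE; have [] := tQ _ ys t tt.
pose w := (1 + t) *: v.
pose a1 := dot l v + 2^-1 * (dot (v *m B) (y - x0) + dot ((y - x0) *m B) v)
      + 2 * d2 * dot (y - x0) v.
pose a2 := 2^-1 * dot (v *m B) v + d2 * dot v v.
pose f (s : R) := u (y + t *: (y - c) + s *: w) - (1 + t) * (1 + t) * u (y + s *: v)
  - 2 * t * ((1 + t) * (1 + t)) * ((psi d2 y + s * a1) + a2 * (s * s)).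
pose df (s : R) := dot w (gradient u (y + t *: (y - c) + s *: w))
  - (1 + t) * (1 + t) * dot v (gradient u (y + s *: v))
  - 2 * t * ((1 + t) * (1 + t)) * (a1 + a2 * (1 * s + s * 1)).
have fE s : f s = K t (y + s *: v).
  by rewrite /f /K TE psi_line /a1 /a2 (mulrC _ (s * s)).
have := @second_order_max R f df (dot w (w *m hessian u (y + t *: (y - c)))
  - (1 + t) * (1 + t) * dot v (v *m hessian u y)
  - 2 * t * ((1 + t) * (1 + t)) * (a2 * (1 + 1))) m m0.
have [Oa Ob] : Omega (y + t *: (y - c) + 0 *: w) /\ Omega (y + 0 *: v) by apply: mO; rewrite normr0.
have did (s : R) := @is_derive_id R R s 1.
have h1 (s : R) : `|s| < m -> is_derive s 1 f (df s).
  move=> /mO [Os1 Os2]; apply: is_derive_sub.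
    apply: is_derive_sub; first exact: (derive_u_line oO C2).
    by apply: is_derive_mulc; exact: (derive_u_line oO C2).
  apply: is_derive_mulc; apply: is_derive_add; first exact: is_derive_linear.
  by apply: is_derive_mulc; apply: is_derive_mul.
have h2 : is_derive (0 : R) 1 df (dot w (w *m hessian u (y + t *: (y - c)))
  - (1 + t) * (1 + t) * dot v (v *m hessian u y)
  - 2 * t * ((1 + t) * (1 + t)) * (a2 * (1 + 1))).
  apply: is_derive_sub.
    apply: is_derive_sub.
      by have := derive_dot_gradient w Oa; rewrite scale0r addr0.
    apply: is_derive_mulc.
    by have := derive_dot_gradient v Ob; rewrite scale0r addr0.
  apply: is_derive_mulc.
  have d1 := @is_derive_cst R R R 1 0 1.
  have e1 := is_derive_add (is_derive_mul d1 (did 0)) (is_derive_mul (did 0) d1).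
  apply: is_derive_eq (is_derive_add (@is_derive_cst R R R a1 0 1) (is_derive_mulc e1 a2)) _.
  by rewrite /cst !(mul0r, mulr0, add0r, addr0, mul1r).
move=> /(_ h1 h2).
have h3 (s : R) : `|s| < m -> f s <= f 0.
  by move=> /mP /ltW ys; rewrite !fE scale0r addr0; apply: ymax.
move=> /(_ h3).
rewrite /w /a2 dotZl -scalemxAl dotZr => h.
rewrite [leLHS]dotC [X in _ <= X + _]dotC.
have t1p : 0 < (1 + t) * (1 + t) by rewrite mulr_gt0 // addr_gt0.
have fin (X1 X2 b N : R) : (1 + t) * ((1 + t) * X1) - (1 + t) * (1 + t) * X2
    - 2 * t * ((1 + t) * (1 + t)) * ((2^-1 * b + d2 * N) * (1 + 1)) <= 0 ->
    X1 <= X2 + 2 * t * (b + d * N).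
  rewrite (_ : _ - _ = (1 + t) * (1 + t) * (X1 - (X2 + 2 * t * (b + d * N)))).
    by rewrite pmulr_rle0 // subr_le0.
  by rewrite /d2 /d4; field.
exact: fin h.
Unshelve. all: by end_near. Qed.

End Touching.

(** * Rigidity when theta is constant *)

Section ConstantPhase.
Variables (R : realType) (n : nat) (Omega : set 'rV[R]_n) (u : 'rV[R]_n -> R) (M : R).
Hypotheses (oO : open Omega) (C2 : C2_on Omega u).
Hypothesis WM : forall x, Omega x -> W u 0 x = M.
Hypothesis blowup : blows_up_at_boundary Omega (fun x => enorm (gradient u x)) \/
   blows_up_at_boundary Omega (fun x => `|u x|).
Implicit Types (x y v p : 'rV[R]_n).

(** The differential [dW] of a constant vanishes in every direction: this is Euler's relation of
    degree one for Du. *)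
Lemma gradient_eq x : Omega x -> x *m hessian u x = gradient u x.
Proof.
move=> Ox.
have dW0 v : dW u 0 x v = 0.
  have Ox' : Omega (x + (0 : R) *: v) by rewrite scale0r addr0.
  have h1 := derive_W_line oO C2 0 Ox'.
  have [r r0 rP] := near_line v (open_nbhs_nbhs (conj oO Ox)).
  have h2 : is_derive (0 : R) 1 (cst M : R -> R) (dW u 0 (x + (0 : R) *: v) v).
    apply: near_eq_is_derive h1; apply/nbhs_norm0P; exists r => //= s sr.
    by rewrite WM //; exact: rP.
  have [_ e1] := h2; have [_ e2] := @is_derive_cst R R R M 0 1.
  by move: e1; rewrite e2 scale0r addr0.
apply/rowP => i; have := dW0 'e_i.
rewrite /dW subr0 => /eqP; rewrite mulf_eq0 invr_eq0 pnatr_eq0 /= subr_eq0 => /eqP.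
have dotE w : dot 'e_i w = w 0 i.
  rewrite /dot (bigD1 i) //= mxE !eqxx mul1r big1 ?addr0 // => l li.
  by rewrite mxE (negbTE li) andbF mul0r.
by rewrite dotC dot_mulmx (hessian_sym oO C2 Ox) !dotE.
Qed.

Lemma u_eq x : Omega x -> u x = 2^-1 * dot x (gradient u x) - M.
Proof. by move=> Ox; rewrite -(WM Ox) /W subr0; ring. Qed.

(* Along a ray the gradient is homogeneous of degree one, hence bounded, so the
   blow-up condition forbids leaving Omega. *)
Lemma ray_closed x p (B : R) : Omega x ->
  (forall P : set 'rV[R]_n, nbhs p P -> exists t : R, [/\ 0 < t, t <= B, P (t *: x),
     Omega (t *: x) & gradient u (t *: x) = t *: gradient u x]) ->
  Omega p.
Proof.
move=> Ox pP; apply: contrapT => nOp.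
have bp : boundary Omega p.
  split; last by move=> /interior_subset.
  by move=> P /pP [t [_ _ Pt Ot _]]; exists (t *: x).
case: blowup => /(_ p bp) /cvgryPgt.
  move=> /(_ (Num.sqrt (B ^+ 2 * dot (gradient u x) (gradient u x)))).
  rewrite near_withinE => /pP [t [t0 tB Pt Ot Gt]].
  have := Pt Ot; rewrite ltNge /enorm Gt dotZl dotZr mulrA -expr2.
  rewrite ler_wsqrtr // ler_wpM2r ?dot_ge0 //.
  by rewrite ler_sqr ?nnegrE // ?(le_trans (ltW t0)) // ltW.
(* By [u_eq] and homogeneity u(t x) = t^2 (x, Du(x)) / 2 - M, which stays bounded for t <= B. *)
move=> /(_ (B ^+ 2 * `|2^-1 * dot x (gradient u x)| + `|M|)).
rewrite near_withinE => /pP [t [t0 tB Pt Ot Gt]].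
have := Pt Ot; rewrite ltNge (u_eq Ot) Gt dotZl dotZr.
rewrite (_ : 2^-1 * _ = t ^+ 2 * (2^-1 * dot x (gradient u x))); last by ring.
rewrite (le_trans (ler_normB _ _)) // lerD2r normrM ler_wpM2r // ger0_norm ?sqr_ge0 //.
by rewrite ler_sqr ?nnegrE // ?(le_trans (ltW t0)) // ltW.
Qed.

Lemma cvg_scale_expR x (s0 : R) : expR s *: x @[s --> s0] --> expR s0 *: x.
Proof. by apply: cvgZr_tmp; exact: continuous_expR. Qed.

(** Writing t = exp s turns the open ray into the connected real line, on which the set [J] of good
    parameters is open, closed and contains 0. *)
Lemma ray_gradient x (t : R) : Omega x -> 0 < t ->
  Omega (t *: x) /\ gradient u (t *: x) = t *: gradient u x.
Proof.
move=> Ox t0.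
pose J : set R := [set s | Omega (expR s *: x) /\
  gradient u (expR s *: x) = expR s *: gradient u x].
suff JT : J = setT by have := JT; rewrite -(lnK t0) => /seteqP [_]; apply.
have cR : connected [set: R].
  by apply/connected_intervalP => a b.
apply: cR.
- by exists 0; rewrite /J /= expR0 !scale1r.
- exists J; last by rewrite setTI.
  suff op (s0 : R) : J s0 -> nbhs s0 J by rewrite openE; exact: op.
  move=> [Os0 Gs0].
  have nO : \forall s \near s0, Omega (expR s *: x).
    by apply: cvg_scale_expR; exact: open_nbhs_nbhs.
  have [r r0 rP] := (nbhs_normP _ _).1 nO.
  apply/nbhs_normP; exists r => //= s sr; split; first exact: rP.
  apply/rowP => i; rewrite [RHS]mxE.
  (* By Euler's relation the rescaled gradient has zero derivative in a, so homogeneity propagates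
     from s0 to s. *)
  pose g (a : R) := expR (- a) * gradient u (expR a *: x) 0 i.
  have dg a : Omega (expR a *: x) -> is_derive a 1 g 0.
    move=> Oa.
    have Oa' : Omega (0 + expR a *: x) by rewrite add0r.
    have h1 := derive_gradient_line oO C2 i Oa'.
    rewrite (_ : (fun s => _) = fun s => gradient u (s *: x) 0 i) in h1; last first.
      by apply/funext => q; rewrite add0r.
    have h2 := @is_derive1_comp R _ expR a _ _ h1 (is_derive_expR a).
    have h3 := @is_derive1_comp R expR -%R a _ _ (is_derive_expR (- a)) (is_deriveNid a 1).
    apply: is_derive_eq (is_derive_mul h3 h2) _.
    rewrite add0r /= -(gradient_eq Oa) -scalemxAl mxE expRN.
    by field; rewrite gt_eqF // expR_gt0.
  have [//|a /andP[a0 a1]|a _] := @MVT01 R (fun a => g (s0 + a * (s - s0))) (fun=> 0 * (s - s0)) 1.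
    have Oa : Omega (expR (s0 + a * (s - s0)) *: x).
      apply: rP => /=; rewrite opprD addrA subrr sub0r normrN normrM ger0_norm //.
      by rewrite (le_lt_trans _ sr) // distrC ler_piMl.
    exact: (@is_derive1_comp R g (fun a => s0 + a * (s - s0)) a _ _ (dg _ Oa)
      (is_derive_linear s0 (s - s0) a)).
  rewrite mul0r mul0r addr0 mul1r (addrC s0) subrK /g Gs0 [X in _ - _ * X]mxE.
  have ne0 (q : R) : expR q != 0 := lt0r_neq0 (expR_gt0 q).
  move=> /eqP; rewrite subr_eq0 !expRN mulrA mulVf ?ne0 // mul1r => /eqP <-.
  by rewrite mulrA mulfV ?mul1r // ne0.
- exists J; last by rewrite setTI.
  (* Closedness: [ray_closed] keeps the limit point in [Omega], and then the gradient identity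
     passes to the limit. *)
  move=> s0 s0cl.
  have Os0 : Omega (expR s0 *: x).
    apply: (@ray_closed x _ (expR (s0 + 1))) => // P nP.
    have nP' : \forall s \near s0, P (expR s *: x) by exact: (@cvg_scale_expR x s0 _ nP).
    have nP2 : \forall s \near s0, s < s0 + 1.
      by apply: (cvgr_lt _ cvg_id); rewrite ltrDl.
    have [s [[Os Gs] [Ps s1]]] := s0cl _ (filterI nP' nP2).
    by exists (expR s); split=> //; [exact: expR_gt0|rewrite ler_expR ltW].
  split=> //; apply/rowP => i; rewrite [RHS]mxE.
  apply/eqP; rewrite -subr_eq0; apply: contraT => ne.
  have c1 : gradient u (expR s *: x) 0 i @[s --> s0] --> gradient u (expR s0 *: x) 0 i.
    apply: (cvg_at (g := fun y => gradient u y 0 i)) (@cvg_scale_expR x s0).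
    exact: cvg_gradient C2.1 Os0.
  have c2 : gradient u (expR s *: x) 0 i - expR s * gradient u x 0 i @[s --> s0] -->
      gradient u (expR s0 *: x) 0 i - expR s0 * gradient u x 0 i.
    by apply: cvgB c1 (cvgM (@continuous_expR R s0) (cvg_cst _)).
  have [s [[Os Gs] ns]] := s0cl _ (cvgr_neq0 _ c2 ne).
  by move: ns; rewrite /= Gs mxE subrr eqxx.
Qed.

Lemma domain_full : Omega !=set0 -> Omega = setT.
Proof.
move=> [x Ox].
have O0 : Omega 0.
  apply: (@ray_closed x 0 1 Ox) => P nP.
  have [m m0 mP] := near_line x nP.
  pose t := Num.min 1 (m / 2).
  have t0 : 0 < t by rewrite lt_min ltr01 divr_gt0.
  have tm : t < m by rewrite gt_min; apply/orP; right; lra.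
  have [Ot Gt] := ray_gradient Ox t0.
  exists t; split=> //; first by rewrite ge_min lexx.
  by rewrite -[_ *: _]add0r; apply: mP; rewrite gtr0_norm.
apply/seteqP; split=> // y _.
have [m m0 mP] := near_line y (open_nbhs_nbhs (conj oO O0)).
have t0 : 0 < m / 2 by rewrite divr_gt0.
have Oy : Omega ((m / 2) *: y).
  by rewrite -[_ *: _]add0r; apply: mP; rewrite gtr0_norm //; lra.
have ti0 : 0 < (m / 2)^-1 by rewrite invr_gt0.
have [] := ray_gradient Oy ti0.
by rewrite scalerA mulVf ?gt_eqF // scale1r.
Qed.

Lemma scale_row_inj (A B : 'M[R]_n) v i (t : R) : t != 0 ->
  t * (v *m B) 0 i = ((t *: v) *m A) 0 i -> (v *m A) 0 i = (v *m B) 0 i.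
Proof. by move=> t0; rewrite -scalemxAl [in RHS]mxE => /(mulfI t0) ->. Qed.

Lemma hessian_ray x (t : R) : Omega = setT -> 0 < t -> hessian u (t *: x) = hessian u x.
Proof.
move=> OT t0; have O y : Omega y by rewrite OT.
have ent (A : 'M[R]_n) (j i : 'I_n) : (('e_j : 'rV[R]_n) *m A) 0 i = A j i by rewrite -rowE mxE.
suff key v i : (v *m hessian u (t *: x)) 0 i = (v *m hessian u x) 0 i.
  by apply/matrixP => j i; exact: etrans (esym (ent _ j i)) (etrans (key _ i) (ent _ j i)).
have h1 : is_derive (0 : R) 1 (fun s => gradient u (t *: x + s *: (t *: v)) 0 i)
    (((t *: v) *m hessian u (t *: x + (0 : R) *: (t *: v))) 0 i).
  exact: (derive_gradient_line oO C2).
have h2 : is_derive (0 : R) 1 (fun s => t * gradient u (x + s *: v) 0 i)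
    (t * (v *m hessian u (x + (0 : R) *: v)) 0 i).
  have h0 : is_derive (0 : R) 1 (fun s => gradient u (x + s *: v) 0 i)
      ((v *m hessian u (x + (0 : R) *: v)) 0 i) by exact: (derive_gradient_line oO C2).
  exact: is_derive_mulc h0 t.
have fE : (fun s : R => gradient u (t *: x + s *: (t *: v)) 0 i) =
    (fun s => t * gradient u (x + s *: v) 0 i).
  apply/funext => s; rewrite scalerA mulrC -scalerA -scalerDr.
  by have [_ ->] := ray_gradient (O (x + s *: v)) t0; rewrite mxE.
rewrite fE in h1.
have [_ e1] := h1; have [_ e2] := h2; move: e1; rewrite e2 !scale0r !addr0.
exact: scale_row_inj (lt0r_neq0 t0).
Qed.

Lemma half_norm_lt (m : R) : 0 < m -> `|m / 2| < m.
Proof. by move=> m0; rewrite gtr0_norm ?divr_gt0 //; lra. Qed.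

Lemma dist_lt_irr (a c : R) : `|a - c| < `|c - a| -> false.
Proof. by rewrite distrC ltxx. Qed.

Lemma hessian_constant x : Omega = setT -> hessian u x = hessian u 0.
Proof.
move=> OT; have O y : Omega y by rewrite OT.
apply/matrixP => i j; apply/eqP; rewrite -subr_eq0; apply: contraT => ne.
have d0 : 0 < `|hessian u x i j - hessian u 0 i j| by rewrite normr_gt0.
have c := @cvg_hessian R n Omega u 0 i j C2 (O 0).
pose P (A : 'M[R]_n) := `|hessian u 0 i j - A i j| < `|hessian u x i j - hessian u 0 i j|.
have nP : \forall y \near (0 : 'rV[R]_n), P (hessian u y).
  by move: c => /cvgrPdist_lt /(_ _ d0).
have [m m0 mP] := near_line x nP.
have m20 : 0 < m / 2 by rewrite divr_gt0.
have e : hessian u (0 + (m / 2) *: x) = hessian u x.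
  by rewrite add0r; exact: hessian_ray.
have mm := half_norm_lt m0.
have : P (hessian u x) := eq_ind _ P (mP (m / 2) mm) _ e.
exact: dist_lt_irr.
Qed.

Lemma quadratic_of_constant_phase : Omega = setT -> quadratic_polynomial u.
Proof.
move=> OT; have O y : Omega y by rewrite OT.
pose H := hessian u 0.
have uE x : u x = 2^-1 * dot (x *m H) x - M.
  by rewrite (u_eq (O x)) -(gradient_eq (O x)) hessian_constant // dotC.
pose mX (i j : 'I_n) : mpoly n R :=
  mpolyX R (mnm_add (mnm1 i) (mnm1 j)).
exists (\sum_i \sum_j (2^-1 * H i j) *: mX i j - mpolyC n M).
  apply: leq_trans (mmeasureD_le _ _ _) _.
  rewrite geq_max mmeasureN mmeasureC; apply/andP; split; last by case: eqP.
  apply: leq_trans (mmeasure_sum _ _ _ _) _; apply/bigmax_leqP => i _.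
  apply: leq_trans (mmeasure_sum _ _ _ _) _; apply/bigmax_leqP => j _.
  apply: leq_trans (mmeasureZ_le _ _ _) _.
  have h : mdeg (mnm_add (mnm1 i) (mnm1 j)) = 2%N by rewrite mdegD !mdeg1.
  by have := msizeX R (mnm_add (mnm1 i) (mnm1 j)); rewrite h /mX => ->.
move=> x; rewrite uE mevalB mevalC; congr (_ - _).
rewrite raddf_sum /= dot_mulmxE mulr_sumr; apply: eq_bigr => i _.
rewrite raddf_sum /= mulr_sumr; apply: eq_bigr => j _.
rewrite mevalZ /mX mpolyXD mevalM !mevalXU; exact: mulrA.
Qed.

End ConstantPhase.

(** * Common abstract form of the three equations *)

Section Profile.
Variable R : realType.

(* D is where the eigenvalues live. The last two fields give two-sided bounds
   on f' along the regions singled out by a lower bound on f or a bound on |t|. *)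
Record profile (f df : R -> R) (D : set R) (b : R) : Prop := Profile {
  profile_open : open D;
  profile_derive : forall t, D t -> is_derive t 1 f (df t);
  profile_bound_ge0 : 0 <= b;
  profile_le : forall t, D t -> f t <= b;
  profile_upper : forall m, exists2 K, 0 <= K &
    forall t, D t -> m <= f t -> df t * (1 + t ^+ 2) <= K;
  profile_lower : forall L, exists2 e, 0 < e &
    forall t, D t -> `|t| <= L -> e <= df t }.

(** The right-hand side is theta, written [W u 0]. The eigenvalues are listed in increasing order so
    that [weyl] applies at every pair of points. *)
Record eigen_equation (n : nat) (Omega : set 'rV[R]_n) (u : 'rV[R]_n -> R)
  (f df : R -> R) (D : set R) (b : R) (lam : 'rV[R]_n -> 'I_n -> R) : Prop := EigenEquation {
  eqn_open : open Omega;
  eqn_C2 : C2_on Omega u;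
  eqn_profile : profile f df D b;
  eqn_spec : forall x, Omega x -> spec (hessian u x) (lam x);
  eqn_sorted : forall x, Omega x -> {homo lam x : i j / (i <= j)%N >-> i <= j};
  eqn_dom : forall x i, Omega x -> D (lam x i);
  eqn_eq : forall x, Omega x -> \sum_(i < n) f (lam x i) = W u 0 x }.

(** The penalty phi. It controls x and Du, hence also u = (x, Du) / 2 - theta where theta is
    bounded, so it interacts with either blow-up condition. *)
Definition energy (n : nat) (u : 'rV[R]_n -> R) (x : 'rV[R]_n) : R :=
  dot x x + dot (gradient u x) (gradient u x).

End Profile.

(** * Continuity of the eigenvalues and the penalised estimate *)

Section Equation.
Variables (R : realType) (n : nat) (Omega : set 'rV[R]_n) (u : 'rV[R]_n -> R).
Variables (f df : R -> R) (D : set R) (b : R) (lam : 'rV[R]_n -> 'I_n -> R).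
Hypothesis E : eigen_equation Omega u f df D b lam.
Local Notation theta := (W u 0).
Local Notation phi := (energy u).
Let oO := eqn_open E.
Let C2 := eqn_C2 E.
Let pf := eqn_profile E.
Let lam_spec := eqn_spec E.
Let lam_sorted := eqn_sorted E.
Let lamD := eqn_dom E.
Let equation := eqn_eq E.
Implicit Types (x y z v p : 'rV[R]_n).

Lemma thetaE x : theta x = - u x + 2^-1 * dot x (gradient u x).
Proof. by rewrite /W subr0. Qed.

Lemma phi_ge0 x : 0 <= phi x.
Proof. by rewrite addr_ge0 // dot_ge0. Qed.

Lemma theta_le x : Omega x -> theta x <= n%:R * b.
Proof.
move=> Ox; rewrite -(equation Ox).
apply: (@le_trans _ _ (\sum_(i < n) b)).
  by apply: ler_sum => i _; apply: profile_le pf _ _; exact: lamD.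
by rewrite sumr_const card_ord -[leLHS]mulr_natl.
Qed.

(** The other n - 1 terms of the sum are at most b, and b >= 0. This is how a bound on theta
    confines every single eigenvalue. *)
Lemma f_lam_ge x (m : R) i : Omega x -> m <= theta x -> m - n%:R * b <= f (lam x i).
Proof.
move=> Ox; rewrite -(equation Ox) (bigD1 i) //= => h.
rewrite lerBlDr (le_trans h) // lerD2l.
apply: (@le_trans _ _ (\sum_(j < n | j != i) b)).
  by apply: ler_sum => j _; apply: profile_le pf _ _; exact: lamD.
rewrite sumr_const -[leLHS]mulr_natl ler_wpM2r ?(profile_bound_ge0 pf) // ler_nat.
by rewrite (leq_trans (max_card _)) // card_ord.
Qed.

Lemma cvg_grad x i : Omega x -> gradient u y 0 i @[y --> x] --> gradient u x 0 i.
Proof. exact: cvg_gradient C2.1. Qed.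

Lemma cvg_theta x : Omega x -> theta y @[y --> x] --> theta x.
Proof.
move=> Ox.
have cu : u y @[y --> x] --> u x by have [] := C2.1 x Ox.
have cd : dot y (gradient u y) @[y --> x] --> dot x (gradient u x).
  by apply: (@cvg_dot R n _ (nbhs x) _ id) => i; [exact: coord_continuous|exact: cvg_grad].
apply: (cvg_pointwise_eq (g := fun y => - u y + 2^-1 * dot y (gradient u y))
  (b := - u x + 2^-1 * dot x (gradient u x))); [exact: thetaE|exact: thetaE|].
have c1 : - u y @[y --> x] --> - u x by apply: (cvg_comp u -%R cu); exact: opp_continuous.
have c2 : 2^-1 * dot y (gradient u y) @[y --> x] --> 2^-1 * dot x (gradient u x).
  by exact: cvgM (cvg_cst (2^-1 : R)) cd.
exact: cvgD c1 c2.
Qed.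

Lemma cvg_phi x : Omega x -> phi y @[y --> x] --> phi x.
Proof.
move=> Ox.
have c1 : dot y y @[y --> x] --> dot x x.
  by apply: (@cvg_dot R n _ (nbhs x) _ id id) => i; exact: coord_continuous.
have c2 : dot (gradient u y) (gradient u y) @[y --> x] --> dot (gradient u x) (gradient u x).
  by apply: (@cvg_dot R n _ (nbhs x) _ (gradient u) (gradient u)) => i; exact: cvg_grad.
exact: cvgD c1 c2.
Qed.

Lemma near_hessian x (e : R) : Omega x -> 0 < e ->
  \forall y \near x, Omega y /\ forall i j, `|hessian u y i j - hessian u x i j| <= e.
Proof.
move=> Ox e0.
have h i j : \forall y \near x, `|hessian u y i j - hessian u x i j| <= e.
  by have /cvgr_distC_le /(_ _ e0) := @cvg_hessian R n Omega u x i j C2 Ox.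
apply: filterI; first exact: open_nbhs_nbhs.
apply: (@filter_forall _ _ (fun i y => forall j, `|hessian u y i j - hessian u x i j| <= e) (nbhs x) _) => i.
by apply: (@filter_forall _ _ (fun j y => `|hessian u y i j - hessian u x i j| <= e) (nbhs x) _) => j; exact: h.
Qed.

(** Weyl's inequality against the Hessian at x shifted by n e times the identity. *)
Lemma lam_le_shift x y (e : R) i : Omega x -> Omega y -> 0 <= e ->
  (forall j k, `|hessian u y j k - hessian u x j k| <= e) ->
  lam y i <= lam x i + n%:R * e.
Proof.
move=> Ox Oy e0 h.
have := spec_poly (n%:R * e) 1 0 (lam_spec Ox); rewrite scale0r addr0 scale1r => sp.
have -> : lam x i + n%:R * e = n%:R * e + 1 * lam x i + 0 * lam x i ^+ 2 by ring.
apply: (weyl _ _ (lam_spec Oy) sp); first exact: lam_sorted.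
  by move=> j k jk; rewrite !mul0r !mul1r !addr0 lerD2l; exact: lam_sorted.
by rewrite addrC; exact: mx_dist_le.
Qed.

Lemma near_lam x (e : R) : Omega x -> 0 < e ->
  \forall y \near x, Omega y /\ forall i, `|lam y i - lam x i| < e.
Proof.
move=> Ox e0.
have e'0 : 0 < e / n.+1%:R by rewrite divr_gt0 // ltr0n.
apply: filterS (near_hessian Ox e'0) => y [Oy h]; split=> // i.
have lt_e : n%:R * (e / n.+1%:R) < e.
  by rewrite mulrCA gtr_pMr // ltr_pdivrMr ?ltr0n // mul1r ltr_nat.
have h' j k : `|hessian u x j k - hessian u y j k| <= e / n.+1%:R by rewrite distrC.
have := lam_le_shift i Ox Oy (ltW e'0) h; have := lam_le_shift i Oy Ox (ltW e'0) h'.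
move: lt_e; move: (n%:R * _) => q qe h1 h2.
by rewrite ltr_distl; apply/andP; split; lra.
Qed.

Lemma cvg_lam x i : Omega x -> lam y i @[y --> x] --> lam x i.
Proof.
move=> Ox; apply/(@cvgrPdist_lt _ _ _ (nbhs x) _) => e e0.
by apply: filterS (near_lam Ox e0) => y [_ h]; rewrite distrC.
Qed.

(** [D] may be disconnected, with f jumping between components, so mean values are taken only inside
    small intervals around the eigenvalues at x; losing 1 in the lower bound keeps one constant K
    valid there. The bound 1/4 on the radius makes 1 + s^2 comparable at two points of an
    interval. *)
Lemma good_radius x (m : R) : Omega x -> m <= theta x ->
  exists2 rho, 0 < rho <= 4^-1 & forall i t, `|t - lam x i| < rho ->
    D t /\ m - n%:R * b - 1 <= f t.
Proof.
move=> Ox mx.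
have h i : \forall r \near (0 : R), forall t, `|t - lam x i| < r ->
    D t /\ m - n%:R * b - 1 <= f t.
  have Di := lamD i Ox.
  have cf : {for lam x i, continuous f}.
    by apply: differentiable_continuous; apply/derivable1_diffP; have [] := profile_derive pf Di.
  have h1 : \forall t \near lam x i, D t /\ m - n%:R * b - 1 <= f t.
    apply: filterI; first exact: open_nbhs_nbhs (conj (profile_open pf) Di).
    apply: (cvgr_ge _ cf); rewrite ltrBlDr (le_lt_trans (f_lam_ge i Ox mx)) //.
    by rewrite ltrDl.
  move: h1 => /nbhs_normP [r /= r0 rP].
  apply/nbhs_norm0P; exists r => //= s sr t ts; apply: rP => /=.
  by rewrite distrC (lt_trans ts) // (le_lt_trans (ler_norm s)).
have : \forall r \near (0 : R), forall i t, `|t - lam x i| < r ->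
    D t /\ m - n%:R * b - 1 <= f t.
  by apply: (@filter_forall _ _ (fun i r => forall t, `|t - lam x i| < r ->
    D t /\ m - n%:R * b - 1 <= f t) (nbhs (0 : R)) _).
move=> /nbhs_norm0P [r /= r0 rP].
have m0 : 0 < Num.min (r / 2) 4^-1 by rewrite lt_min divr_gt0 //= invr_gt0.
exists (Num.min (r / 2) 4^-1); first by rewrite m0 ge_min lexx orbT.
by apply: rP => /=; rewrite gtr0_norm // gt_min; apply/orP; left; lra.
Qed.

Lemma mean_value x (rho s t : R) i :
  (forall t, `|t - lam x i| < rho -> D t) ->
  `|s - lam x i| < rho -> `|t - lam x i| < rho ->
  exists2 xi, `|xi - lam x i| < rho /\ `|xi - s| <= `|t - s| & f t - f s = df xi * (t - s).
Proof.
move=> hD hs ht.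
have seg a : 0 <= a <= 1 -> `|s + a * (t - s) - lam x i| < rho.
  move=> /andP[a0 a1]; move: hs ht; rewrite !ltr_distl => /andP[h1 h2] /andP[h3 h4].
  have key X Y : 0 < X -> 0 < Y -> 0 < (1 - a) * X + a * Y.
    move=> X0 Y0; have [->|an0] := eqVneq a 0; first by rewrite subr0 mul1r mul0r addr0.
    have ap : 0 < a by rewrite lt_def an0.
    by rewrite ltr_wpDl ?mulr_gt0 // mulr_ge0 ?subr_ge0 // ltW.
  have k1 := key (s - (lam x i - rho)) (t - (lam x i - rho)).
  have k2 := key (lam x i + rho - s) (lam x i + rho - t).
  rewrite !subr_gt0 in k1 k2; have := k1 h1 h3; have := k2 h2 h4.
  by move=> k3 k4; apply/andP; split; lra.
have [//|a a01|a /andP[a0 a1] EE] := @MVT01 R (fun a => f (s + a * (t - s)))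
   (fun a => df (s + a * (t - s)) * (t - s)) 1.
  have Da := hD _ (seg a a01).
  exact: (@is_derive1_comp R f (fun a => s + a * (t - s)) a _ _ (profile_derive pf Da)
    (is_derive_linear s (t - s) a)).
exists (s + a * (t - s)); last first.
  by move: EE; rewrite mul1r mul0r addr0 mulr1 (addrC s) subrK.
split; first by apply: seg; rewrite a0.
by rewrite (addrC s) addrK normrM ger0_norm // ler_piMl.
Qed.

Lemma dot_gradient_partial x v i : Omega x ->
  dot v (gradient (partial i u) x) = (v *m hessian u x) 0 i.
Proof.
move=> Ox; rewrite gradient_partialE -[in RHS](hessian_sym oO C2 Ox) mxE.
by apply: eq_bigr => j _; rewrite !mxE.
Qed.

(** The square of Du(y) - Du(x) = D^2u(x) (y - x) + o(|y - x|). *)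
Lemma gradient_increment x (d : R) : Omega x -> 0 < d ->
  \forall y \near x, dot (gradient u y - gradient u x) (gradient u y - gradient u x)
    <= dot ((y - x) *m hessian u x) ((y - x) *m hessian u x) + d * dot (y - x) (y - x).
Proof.
move=> Ox d0; pose a := \sum_i \sum_j `|hessian u x i j|.
have a0 : 0 <= a by apply: sumr_ge0 => i _; apply: sumr_ge0 => j _.
(* With increments off by e N and linear part at most a N, a coordinate contributes 2 e a N^2 + e^2
   N^2 <= e (2 a + 1) N^2, and there are n coordinates. *)
pose c := n.+1%:R * (2 * a + 1).
have c0 : 0 < c by rewrite mulr_gt0 ?ltr0n // ltr_wpDl // mulr_ge0.
pose e := Num.min 1 (d / c).
have e0 : 0 < e by rewrite lt_min ltr01 divr_gt0.
have e1 : e <= 1 by rewrite ge_min lexx.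
have ed : e * c <= d by rewrite -ler_pdivlMr // ge_min lexx orbT.
apply/nbhs0P => /=.
have : \forall h \near (0 : 'rV[R]_n), forall i,
    `|partial i u (x + h) - partial i u x - dot h (gradient (partial i u) x)| <= e * `|h|.
  apply: (@filter_forall _ _ (fun i h => `|partial i u (x + h) - partial i u x -
    dot h (gradient (partial i u) x)| <= e * `|h|) (nbhs (0 : 'rV[R]_n)) _) => i.
  exact: C1_taylor oO (C2.2 i) Ox _ e0.
apply: filterS => h hP.
rewrite (addrC x) addrK.
set N := `|h| in hP; have N0 : 0 <= N by rewrite normr_ge0.
have key i : (gradient u (h + x) - gradient u x) 0 i ^+ 2 <=
    ((h *m hessian u x) 0 i) ^+ 2 + e * (2 * a + 1) * N ^+ 2.
  have := hP i; rewrite dot_gradient_partial // (addrC x).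
  rewrite [X in X ^+ 2 <= _]mxE [X in (X + _) ^+ 2 <= _]mxE.
  rewrite [X in (_ + X) ^+ 2 <= _]mxE [X in (_ - X) ^+ 2 <= _]mxE.
  have wa : `|(h *m hessian u x) 0 i| <= a * N.
    rewrite mxE (le_trans (ler_norm_sum _ _ _)) // /a mulr_suml.
    apply: ler_sum => j _; rewrite normrM mulrC.
    apply: ler_pM; rewrite ?normr_ge0 //; last exact: coord_le_norm.
    by rewrite (bigD1 i) //= lerDl; apply: sumr_ge0.
  move: ((h *m hessian u x) 0 i) wa => w wa.
  move: (partial i u (h + x) - partial i u x) => q.
  move=> qa.
  have eN : 0 <= e * N by rewrite mulr_ge0 // ltW.
  have aN : 0 <= a * N by rewrite mulr_ge0.
  have m1 : (q - w) * w <= e * N * (a * N).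
    by rewrite (le_trans (ler_norm _)) // normrM ler_pM.
  have m2 : (q - w) ^+ 2 <= (e * N) ^+ 2.
    by rewrite -(real_normK (num_real (q - w))) ler_sqr.
  have m3 : (e * N) ^+ 2 <= e * N ^+ 2.
    by rewrite exprMn ler_wpM2r ?sqr_ge0 // expr2 ler_piMr // ltW.
  have -> : q ^+ 2 = w ^+ 2 + 2 * ((q - w) * w) + (q - w) ^+ 2 by ring.
  have -> : e * (2 * a + 1) * N ^+ 2 = 2 * (e * N * (a * N)) + e * N ^+ 2 by ring.
  by rewrite -addrA lerD2l lerD ?ler_wpM2l // (le_trans m2).
apply: (@le_trans _ _ (\sum_i (((h *m hessian u x) 0 i) ^+ 2 + e * (2 * a + 1) * N ^+ 2))).
  by apply: ler_sum => i _; rewrite -expr2; exact: key.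
rewrite big_split /= sumr_const card_ord; apply: lerD.
  by apply: ler_sum => i _; rewrite expr2.
apply: (@le_trans _ _ (d * N ^+ 2)); last by rewrite ler_wpM2l ?(ltW d0) // norm_sqr_le_dot.
rewrite -[leLHS]mulr_natl mulrA ler_wpM2r ?sqr_ge0 // (le_trans _ ed) //.
rewrite mulrCA ler_wpM2l ?(ltW e0) // /c ler_wpM2r //; last by rewrite ler_nat.
by rewrite addr_ge0 // mulr_ge0.
Qed.

Lemma near_hessian_sqr x (d : R) : Omega x -> 0 < d ->
  \forall y \near x, mx_le (hessian u x *m hessian u x) (hessian u y *m hessian u y + d%:M).
Proof.
move=> Ox d0; pose e := d / n.+1%:R.
have e0 : 0 < e by rewrite divr_gt0 // ltr0n.
pose S y := hessian u y *m hessian u y.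
have cS i j : S y i j @[y --> x] --> S x i j.
  apply: (cvg_pointwise_eq (g := fun y => \sum_k hessian u y i k * hessian u y k j)
    (b := \sum_k hessian u x i k * hessian u x k j)) => [y||]; [by rewrite mxE|by rewrite mxE|].
  apply: (cvg_bigsum (F := nbhs x)) => k.
  have h1 := @cvg_hessian R n Omega u x i k C2 Ox.
  have h2 := @cvg_hessian R n Omega u x k j C2 Ox.
  exact: cvgM h1 h2.
have h i j : \forall y \near x, `|S x i j - S y i j| <= e.
  by have /(@cvgrPdist_le _ _ _ (nbhs x) _) /(_ _ e0) := cS i j.
have : \forall y \near x, forall i j, `|S x i j - S y i j| <= e.
  apply: (@filter_forall _ _ (fun i y => forall j, `|S x i j - S y i j| <= e) (nbhs x) _) => i.
  by apply: (@filter_forall _ _ (fun j y => `|S x i j - S y i j| <= e) (nbhs x) _) => j; exact: h.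
apply: filterS => y hy v.
apply: le_trans (mx_dist_le (ltW e0) hy v) _.
rewrite !mulmxDr !dotDl lerD2l !mul_mx_scalar !dotZl ler_wpM2r ?dot_ge0 //.
by rewrite /e mulrCA ler_piMr ?(ltW d0) // ler_pdivrMr ?ltr0n // mul1r ler_nat.
Qed.

Lemma quad_sqr (M : 'M[R]_n) v : M^T = M -> dot (v *m (M *m M)) v = dot (v *m M) (v *m M).
Proof. by move=> Ms; rewrite mulmxA dot_mulmx Ms. Qed.

(** Trades A^2, taken at x0, for H^2, taken at y, so that the upper bound for T is a polynomial in H
    alone. Doubling 2 eps to 4 eps pays for the 1/4 and for the slack eps. *)
Lemma barrier_mx_le (A H T : 'M[R]_n) (eps t : R) : A^T = A -> H^T = H ->
  0 < eps -> 0 < t -> mx_le (A *m A) (H *m H + (4^-1)%:M) ->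
  (forall v, dot (v *m T) v <= dot (v *m H) v +
     2 * t * (dot (v *m ((2 * eps)%:M + (2 * eps) *: (A *m A))) v + eps * dot v v)) ->
  mx_le T ((2 * t * (4 * eps))%:M + 1 *: H + (2 * t * (4 * eps)) *: (H *m H)).
Proof.
move=> As Hs e0 t0 AH hT v; apply: le_trans (hT v) _.
have := AH v; rewrite !(mulmxDr v) !dotDl !mul_mx_scalar -!scalemxAr !dotZl !quad_sqr //.
have := dot_ge0 v; have := dot_ge0 (v *m H).
move: (dot v v) (dot (v *m A) _) (dot (v *m H) (v *m H)) (dot (v *m H) v) => vv vA vH q vH0 vv0 h.
rewrite mul1r -subr_ge0.
have -> : 2 * t * (4 * eps) * vv + q + 2 * t * (4 * eps) * vH -
  (q + 2 * t * (2 * eps * vv + 2 * eps * vA + eps * vv)) =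
  2 * t * eps * (2 * (vH + 4^-1 * vv - vA) + 2 * vH + 2^-1 * vv) by field.
rewrite mulr_ge0 //; first by rewrite mulr_ge0 ?mulr_ge0 // ltW.
by lra.
Qed.

Lemma near_touching x c (e rho : R) : Omega x -> 0 < e -> 0 < rho ->
  \forall p \near ((0 : R), x),
    [/\ Omega p.2, Omega (p.2 + p.1 *: (p.2 - c)),
        forall i, `|lam p.2 i - lam x i| < rho,
        forall i, `|lam (p.2 + p.1 *: (p.2 - c)) i - lam x i| < rho &
        0 <= p.1 -> p.1 * (dW u 0 x (x - c) - e) <=
          theta (p.2 + p.1 *: (p.2 - c)) - theta p.2].
Proof.
move=> Ox e0 r0.
have h1 : \forall p \near ((0 : R), x), Omega p.2 /\ forall i, `|lam p.2 i - lam x i| < rho.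
  exact: near_snd (near_lam Ox r0).
have h2 : \forall p \near ((0 : R), x), Omega (p.2 + p.1 *: (p.2 - c)) /\
    forall i, `|lam (p.2 + p.1 *: (p.2 - c)) i - lam x i| < rho.
  exact: (@cvg_scaling R n c x _ (near_lam Ox r0)).
have h3 := @W_increment R n Omega u oO C2 c 0 x e Ox e0.
by apply: filterS3 h1 h2 h3 => p [? ?] [? ?] ?; split.
Qed.

(* With c = 4 eps Du(x0), the function theta - 2 eps Du(x0) . Du touches the
   quadratic psi from below at x0; at that point the drift term is exactly
   2 eps phi(x0), while the second order term is O(eps). *)
Lemma barrier_bound (m : R) : exists2 C0, 0 < C0 & forall (eps : R) x0,
  0 < eps -> Omega x0 -> m <= theta x0 ->
  (forall y, Omega y -> theta y - eps * phi y <= theta x0 - eps * phi x0) ->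
  phi x0 <= C0.
Proof.
have [K K0 KP] := profile_upper pf (m - n%:R * b - 1).
(* The argument ends with 2 phi(x0) - 1 <= 16 n K; the essential point is that eps has cancelled. *)
exists (8 * (n%:R * K) + 1).
  by rewrite ltr_wpDl // !mulr_ge0.
move=> eps x0 e0 Ox mx xmax.
pose p := gradient u x0; pose A := hessian u x0.
pose c := (4 * eps) *: p; pose l := (2 * eps) *: x0.
pose B := (2 * eps)%:M + (2 * eps) *: (A *m A).
have As : A^T = A := hessian_sym oO C2 Ox.
have BE v : dot (v *m B) v = 2 * eps * (dot v v + dot (v *m A) (v *m A)).
  by rewrite /B mulmxDr mul_mx_scalar -scalemxAr dotDl !dotZl quad_sqr // mulrDr.
have WE y : W u c y = theta y - 2 * eps * dot p (gradient u y).
  by rewrite /W subr0 dotBl dotZl; field.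
(* Expand |y|^2 about x0 and |Du(y)|^2 about p. The part linear in Du is absorbed by the centre c,
   and the square |Du(y) - p|^2 is estimated with error d / eps, which the factor eps turns into
   d. *)
have touch d : 0 < d -> \forall y \near x0, W u c y <= W u c x0 +
    (dot l (y - x0) + 2^-1 * dot ((y - x0) *m B) (y - x0) + d * dot (y - x0) (y - x0)).
  move=> d0.
  apply: filterS2 (open_nbhs_nbhs (conj oO Ox)) (gradient_increment Ox (divr_gt0 d0 e0)).
  move=> y Oy hy; rewrite !WE BE.
  have hx := xmax y Oy; move: hx hy; rewrite /energy -/p.
  have -> : dot y y = dot x0 x0 + 2 * dot x0 (y - x0) + dot (y - x0) (y - x0).
    by have := dot_sqrD x0 (y - x0); rewrite (addrC x0) subrK.
  rewrite !(dotBl _ _ (gradient u y - p)) !(dotBr _ _ p) !(dotBr _ _ (gradient u y)) (dotC _ p).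
  rewrite dotZl -/A.
  move: (dot x0 x0) (dot x0 (y - x0)) (dot (y - x0) (y - x0)) (dot p (gradient u y)).
  move: (dot (gradient u y) (gradient u y)) (dot p p) (dot ((y - x0) *m A) ((y - x0) *m A)).
  move=> PP pp hA xx xh hh pP h1 h2.
  have h3 : eps * (PP - pP - (pP - pp)) <= eps * hA + d * hh.
    have -> : eps * hA + d * hh = eps * (hA + d / eps * hh) by field; rewrite gt_eqF.
    by rewrite ler_wpM2l ?(ltW e0).
  clear -h1 h3; lra.
have dWE v := touching_first_order oO C2 Ox touch v.
(* Take v = x0 in the first order condition, which yields 2 eps |x0|^2. Symmetry of A exchanges the
   direction x0 - c and the base vector x0, and what remains is (c, p) / 2 = 2 eps |p|^2. *)
have drift : dW u 0 x0 (x0 - c) = 2 * eps * phi x0.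
  have := dWE x0; rewrite /dW subr0 /l dotZl -/p -/A dotBl (dotC x0 p) /energy -/p => h.
  have -> : dot x0 ((x0 - c) *m A) = dot (x0 - c) (x0 *m A).
    by rewrite dotC dot_mulmx As.
  rewrite (dotBl x0 c p) [dot c p]dotZl; rewrite (dotC x0 p).
  rewrite dotBl.
  by move: h; rewrite mulrBr; move: (dot p x0) => q h; lra.
pose Lm := \sum_i `|lam x0 i| + 1.
have Lm1 : 1 <= Lm by rewrite lerDr; apply: sumr_ge0.
have LmP i : `|lam x0 i| <= Lm - 1 by rewrite /Lm addrK (bigD1 i) //= lerDl; apply: sumr_ge0.
have [rho /andP[rho0 rho4] rhoP] := good_radius Ox mx.
have nP : \forall q \near ((0 : R), x0), [/\ Omega q.2, Omega (q.2 + q.1 *: (q.2 - c)),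
        forall i, `|lam q.2 i - lam x0 i| < rho,
        forall i, `|lam (q.2 + q.1 *: (q.2 - c)) i - lam x0 i| < rho &
        0 <= q.1 -> q.1 * (dW u 0 x0 (x0 - c) - eps) <=
          theta (q.2 + q.1 *: (q.2 - c)) - theta q.2] /\
     (mx_le (A *m A) (hessian u q.2 *m hessian u q.2 + (4^-1)%:M) /\ `|q.1| < (16 * eps * Lm)^-1).
  apply: filterI; first exact: near_touching.
  apply: filterI.
    have q0 : 0 < (4^-1 : R) by rewrite invr_gt0.
    exact: near_snd (near_hessian_sqr Ox q0).
  have i0 : 0 < (16 * eps * Lm)^-1 by rewrite invr_gt0 !mulr_gt0 // (lt_le_trans ltr01).
  apply: (@near_fst R n x0 (fun s => `|s| < (16 * eps * Lm)^-1)).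
  apply: filterS (nbhsx_ballx (0 : R) _ i0) => s.
  by rewrite /ball /= sub0r normrN.
have [t [y [t0 [[Oy OT ly lT inc] [AH tL]] hess]]] := touching oO C2 Ox touch e0 nP.
rewrite /= in Oy OT ly lT inc AH tL hess.
set T := y + t *: (y - c) in OT lT inc hess.
pose a := 2 * t * (4 * eps); have a0 : 0 <= a by rewrite !mulr_ge0 // ltW.
(* The smallness of t makes s + a s^2 nondecreasing for |s| <= Lm, so the eigenvalues of the
   comparison matrix are still in increasing order. *)
have aL : a * (2 * Lm) <= 1.
  move: tL; rewrite gtr0_norm // => tL.
  have q0 : 0 < 16 * eps * Lm by rewrite !mulr_gt0 // (lt_le_trans ltr01).
  have : t * (16 * eps * Lm) <= 1 by rewrite -ler_pdivlMr // mul1r ltW.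
  by move=> h; rewrite (_ : _ * _ = t * (16 * eps * Lm)) // /a; ring.
have lyL i : `|lam y i| <= Lm.
  rewrite -[lam y i](subrK (lam x0 i)) (le_trans (ler_normD _ _)) //.
  have := ly i; have := LmP i => *; lra.
have lamT i : lam T i <= a + 1 * lam y i + a * lam y i ^+ 2.
  have sp := spec_poly a 1 a (lam_spec Oy).
  apply: (weyl (lam_sorted OT) _ (lam_spec OT) sp).
    move=> j k jk; rewrite -!addrA lerD2l !mul1r.
    have jk' := lam_sorted Oy jk.
    have := lyL j; have := lyL k; rewrite !ler_norml => /andP[k1 k2] /andP[j1 j2].
    rewrite -subr_ge0 (_ : _ - _ = (lam y k - lam y j) * (1 + a * (lam y k + lam y j))); last by ring.
    rewrite mulr_ge0 ?subr_ge0 //.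
    have : a * (- (2 * Lm)) <= a * (lam y k + lam y j) by rewrite ler_wpM2l //; lra.
    by rewrite mulrN => h; lra.
  exact: barrier_mx_le As (hessian_sym oO C2 Oy) e0 t0 AH hess.
have dfl i : f (lam T i) - f (lam y i) <= 2 * a * K.
  have [xi [hx1 hx2] ->] := @mean_value x0 rho (lam y i) (lam T i) i
    (fun s hs => (rhoP i s hs).1) (ly i) (lT i).
  have [Dxi fxi] := rhoP i xi hx1.
  have [e' e'0 eP] := profile_lower pf `|xi|.
  have dxi : 0 <= df xi by rewrite (le_trans (ltW e'0)) // eP.
  have := KP xi Dxi fxi.
  have h1 : lam T i - lam y i <= a * (1 + lam y i ^+ 2).
    by have := lamT i; rewrite mul1r; lra.
  (* The increment is measured at lam y i but the slope at xi; both lie within 1/4 of lam x0 i, so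
     the weights differ by a factor at most 2. *)
  have h2 : 1 + lam y i ^+ 2 <= 2 * (1 + xi ^+ 2).
    have : `|xi - lam y i| <= 2^-1.
      rewrite -[xi](subrK (lam x0 i)) -addrA (le_trans (ler_normD _ _)) // (distrC (lam x0 i)).
      by have := ly i; lra.
    rewrite ler_norml => /andP[]; move: (lam y i) => s hs1 hs2.
    have := sqr_ge0 (2 * xi - s); nra.
  have h3 : df xi * (lam T i - lam y i) <= df xi * (a * (2 * (1 + xi ^+ 2))).
    by rewrite ler_wpM2l // (le_trans h1) // ler_wpM2l.
  move=> h4; apply: (le_trans h3).
  rewrite (_ : df xi * (a * _) = 2 * a * (df xi * (1 + xi ^+ 2))); last by ring.
  by rewrite ler_wpM2l // mulr_ge0.
have := inc (ltW t0); rewrite drift -(equation Oy) -(equation OT) -sumrB => h1.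
have h2 : \sum_(i < n) (f (lam T i) - f (lam y i)) <= n%:R * (2 * a * K).
  apply: (@le_trans _ _ (\sum_(i < n) 2 * a * K)); first by apply: ler_sum => i _.
  by rewrite sumr_const card_ord -[leLHS]mulr_natl.
have := le_trans h1 h2.
rewrite (_ : t * _ = (t * eps) * (2 * phi x0 - 1)); last by ring.
rewrite (_ : n%:R * _ = (t * eps) * (16 * (n%:R * K))); last by rewrite /a; ring.
by rewrite ler_pM2l ?mulr_gt0 // => h3; lra.
Qed.

(** * Strong maximum principle for theta *)

Lemma quad_rank1 v (h : 'rV[R]_n) (g k a : R) :
  dot (h *m (g *: (k%:M - a *: (v^T *m v)))) h = g * (k * dot h h - a * dot v h ^+ 2).
Proof.
have hv : h *m v^T = (dot h v)%:M by rewrite [LHS]mx11_scalar dot_mxE.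
rewrite -scalemxAr dotZl mulmxBr mul_mx_scalar -scalemxAr mulmxA hv mul_scalar_mx.
by rewrite dotBl !dotZl (dotC h v) expr2.
Qed.

Lemma cvg_dist y z : dot (w - y) (w - y) @[w --> z] --> dot (z - y) (z - y).
Proof.
apply: (@cvg_dot R n _ (nbhs z) _ (fun w => w - y) (fun w => w - y)) => i;
  by apply: (@cvg_coord R n _ (nbhs z) _ (fun w => w - y)); exact: cvgB cvg_id (cvg_cst y).
Qed.

(** The matrix replaces the Hessian of - eps exp (- al |w - y|^2) at z. Its rank-one coefficient is
    al instead of the exact 2 al because [expR_quadratic_lower] has t^2 / 4 in place of t^2 / 2,
    which leaves a true inequality and still a gain of order al. *)
Lemma barrier_touch y z (eps al : R) : Omega z -> 0 < eps -> 0 < al ->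
  (\forall w \near z, theta w + eps * expR (- al * dot (w - y) (w - y)) <=
     theta z + eps * expR (- al * dot (z - y) (z - y))) ->
  let g := eps * expR (- al * dot (z - y) (z - y)) * al in
  forall d, 0 < d -> \forall w \near z, W u 0 w <= W u 0 z +
    (dot ((2 * g) *: (z - y)) (w - z) + 2^-1 * dot ((w - z) *m
       ((2 * g) *: (1%:M - al *: ((z - y)^T *m (z - y))))) (w - z)
     + d * dot (w - z) (w - z)).
Proof.
move=> Oz e0 al0 hmax g d d0.
pose v := z - y; rewrite -/v.
have E0 : 0 < expR (- al * dot v v) := expR_gt0 _.
have g0 : 0 < g by rewrite !mulr_gt0.
have cv : dot v (w - z) @[w --> z] --> dot v (z - z).
  apply: (@cvg_dot R n _ (nbhs z) _ (fun=> v) (fun w => w - z)) => i; first exact: cvg_cst.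
  by apply: (@cvg_coord R n _ (nbhs z) _ (fun w => w - z)); exact: cvgB cvg_id (cvg_cst z).
(* [n2] and [n3] give t <= 2 in the exponential bound; [n1] lets the slack d absorb the mixed cubic
   term of t^2. *)
have n1 : \forall w \near z, - (d / (g * al)) < dot v (w - z).
  by apply: (cvgr_gt _ cv); rewrite subrr dot0r oppr_lt0 divr_gt0 // mulr_gt0.
have n2 : \forall w \near z, dot v (w - z) < (2 * al)^-1.
  by apply: (cvgr_lt _ cv); rewrite subrr dot0r invr_gt0 mulr_gt0.
have n3 : \forall w \near z, dot (w - z) (w - z) < al^-1.
  by apply: (cvgr_lt _ (@cvg_dist z z)); rewrite subrr dot0r invr_gt0.
apply: filterS3 hmax (filterI n1 n2) n3 => w hw [w1 w2] w3.
rewrite dotZl quad_rank1 mul1r.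
have sE : dot (w - y) (w - y) = dot v v + (2 * dot v (w - z) + dot (w - z) (w - z)).
  have -> : w - y = v + (w - z) by rewrite /v [RHS]addrC addrA subrK.
  by rewrite dot_sqrD addrA.
set t := al * (2 * dot v (w - z) + dot (w - z) (w - z)).
have t2 : t <= 2.
  have h1 : dot v (w - z) * (2 * al) <= 1 by rewrite -ler_pdivlMr ?mulr_gt0 // mul1r ltW.
  have h2 : dot (w - z) (w - z) * al <= 1 by rewrite -ler_pdivlMr // mul1r ltW.
  by rewrite /t; lra.
have w1' : 0 <= d + g * al * dot v (w - z).
  have := ltW w1; rewrite -mulNr ler_pdivrMr ?mulr_gt0 // => h; lra.
move: hw; rewrite sE mulrDr expRD -/v (_ : - al * (2 * _ + _) = - t); last by rewrite /t mulNr.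
have := expR_quadratic_lower t2; have q0 := dot_ge0 (w - z).
rewrite /t {t t2}; move: (expR (- (al * _))) => e.
move: w1'; rewrite /g -/v; move: (dot v (w - z)) (dot (w - z) (w - z)) q0 (expR (- al * dot v v)) E0.
move=> a q q0 Ez Ez0 w1' he hw.
have h1 : eps * (Ez * (1 - al * (2 * a + q) + (al * (2 * a + q)) ^+ 2 / 4)) <= eps * (Ez * e).
  by rewrite !ler_wpM2l // ltW.
have h2 : 0 <= q * (d + eps * Ez * al * al * a) by rewrite mulr_ge0.
have h3 : 0 <= eps * Ez * al * al * q ^+ 2 by rewrite !mulr_ge0 ?sqr_ge0 // ltW.
have id1 : eps * (Ez * (1 - al * (2 * a + q) + (al * (2 * a + q)) ^+ 2 / 4)) =
  eps * Ez - (2 * (eps * Ez * al) * a + 2^-1 * (2 * (eps * Ez * al) * (q - al * a ^+ 2)) + d * q)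
  + q * (d + eps * Ez * al * al * a) + eps * Ez * al * al * q ^+ 2 / 4 by field.
move: h1; rewrite id1; move: (eps * Ez * al * al * q ^+ 2) h3 => h3' h3 h1; lra.
Qed.

(* Hopf: on the annulus rho0 <= |x - y|^2 <= r the strict subsolution
   exp (- al |x - y|^2) forces a maximum of theta + eps exp (- al |x - y|^2) at
   an interior point, which contradicts the touching inequality for large al. *)
Lemma strong_maximum_ball (M r : R) y x1 : (forall x, Omega x -> theta x <= M) ->
  0 < r -> (forall x, dot (x - y) (x - y) <= r -> Omega x) ->
  theta y < M -> dot (x1 - y) (x1 - y) < r -> theta x1 < M.
Proof.
move=> maxM r0 ball_sub yM x1r.
pose s x := dot (x - y) (x - y).
have Ox1 : Omega x1 by apply: ball_sub; exact: ltW.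
rewrite lt_def maxM // andbT; apply/eqP => x1M.
have Oy : Omega y by apply: ball_sub; rewrite subrr dot0l ltW.
pose eta0 := (M - theta y) / 2; have eta0_gt : 0 < eta0 by rewrite divr_gt0 // subr_gt0.
have : \forall x \near y, theta x < M - eta0.
  by apply: (cvgr_lt _ (cvg_theta Oy)); rewrite /eta0; lra.
move=> /nbhs_dotP [rho0 rho0_gt rho0P].
have [K K0 KP] := profile_upper pf (M - 1 - n%:R * b - 1).
(* Eigenvalues are bounded on the closed ball, so the equation is uniformly elliptic there with
   constant [eta]. *)
have [L LP] : exists L : R, forall x i, s x <= r -> `|lam x i| <= L.
  have [|||z _ zmax] := @compact_EVT_max 'rV[R]_n R (fun x => \sum_i `|lam x i|) [set x | s x <= r].
  - by exists y; rewrite /= /s subrr dot0l ltW.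
  - exact: dot_ball_compact.
  - apply: continuous_in_subspaceT => z /[!inE] /= zr; have Oz := ball_sub z zr.
    apply: (cvg_bigsum (F := nbhs z)) => i.
    exact: (cvg_norm (cvg_lam (i := i) Oz)).
  exists (\sum_i `|lam z i|) => x i xr.
  apply: le_trans (zmax x _); last by rewrite inE.
  by rewrite (bigD1 i) //= lerDl; apply: sumr_ge0.
have [eta eta_gt etaP] := profile_lower pf (L + 1).
(* Chosen so that 4 eta al rho0 exceeds both the second order loss 8 n K and the possibly negative
   drift, which is bounded in terms of |y|. *)
pose al := (8 * (n%:R * K) + 2 + 2 * dot y y) / (4 * eta * rho0).
have al_gt : 0 < al.
  rewrite divr_gt0 ?mulr_gt0 // ltr_wpDr ?mulr_ge0 ?dot_ge0 //.
  by rewrite ltr_wpDl // !mulr_ge0.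
pose eps := Num.min 1 (eta0 / 2).
have eps_gt : 0 < eps by rewrite lt_min ltr01 divr_gt0.
have eps1 : eps <= 1 by rewrite ge_min lexx.
have eps_eta : eps < eta0.
  by rewrite (@le_lt_trans _ _ (eta0 / 2)) ?ge_min ?lexx ?orbT //; lra.
pose ex x := expR (- al * s x).
have ex_gt x : 0 < ex x := expR_gt0 _.
have ex_le x : ex x <= 1 by rewrite -expR0 ler_expR mulNr oppr_le0 mulr_ge0 ?dot_ge0 // ltW.
have cs z : s w @[w --> z] --> s z := @cvg_dist y z.
have cex z : ex w @[w --> z] --> ex z.
  by apply: (cvg_comp (fun w => - al * s w) expR (cvgM (cvg_cst (- al)) (cs z))); exact: continuous_expR.
have cann : compact [set x | rho0 <= s x <= r].
  apply: (@subclosed_compact _ _ [set x | s x <= r]); last first.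
  - by move=> x /= /andP[].
  - exact: dot_ball_compact.
  rewrite (_ : [set x | _] = s @^-1` [set q | rho0 <= q <= r]) //.
  apply: closed_comp => [x _|]; first exact: cs.
  rewrite (_ : [set q | _] = [set q | rho0 <= q] `&` [set q | q <= r]).
    by apply: closedI; [exact: closed_ge|exact: closed_le].
  by apply/seteqP; split => [q /= /andP[h1 h2]|q /= [h1 h2]]; [split|apply/andP].
have rho_x1 : rho0 < s x1.
  rewrite ltNge; apply/negP => /rho0P; rewrite x1M => ?; lra.
have [z /andP[rhoz zr] zmax] : exists2 z : 'rV[R]_n, rho0 <= s z <= r &
    forall x, rho0 <= s x <= r -> theta x + eps * ex x <= theta z + eps * ex z.
  have [|||z zA zmax] := @compact_EVT_max 'rV[R]_n R (fun x => theta x + eps * ex x)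
      [set x | rho0 <= s x <= r].
  - by exists x1 => /=; rewrite !ltW.
  - exact: cann.
  - apply: continuous_in_subspaceT => z /[!inE] /= /andP[_ zr]; have Oz := ball_sub z zr.
    have c1 := cvg_theta Oz.
    exact: cvgD c1 (cvgM (cvg_cst eps) (cex z)).
  by rewrite inE in zA; exists z => // x xA; apply: zmax; rewrite inE.
have Oz := ball_sub z zr.
have Hx1 : M + eps * ex x1 <= theta z + eps * ex z.
  by rewrite {1}x1M; apply: zmax; rewrite !ltW.
(* On the inner sphere theta is below M - eta0 and eps < eta0 cannot compensate; on the outer
   sphere, treated next, the exponential is smaller than at x1, where theta already equals M. *)
have rhoz' : rho0 < s z.
  rewrite lt_neqAle rhoz andbT; apply/eqP => rz.
  have h1 : theta z < M - eta0 by apply: rho0P; rewrite -/(s z) rz.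
  have h2 : eps * ex z <= eps by rewrite ler_piMr // ltW.
  have h3 : 0 < eps * ex x1 by rewrite mulr_gt0.
  by move: Hx1; lra.
have zr' : s z < r.
  rewrite lt_neqAle zr andbT; apply/eqP => rz.
  have h1 : ex z < ex x1 by rewrite ltr_expR !mulNr ltrN2 ltr_pM2l // rz.
  have h2 : eps * ex z < eps * ex x1 by rewrite ltr_pM2l.
  by have := maxM z Oz; move: Hx1; lra.
have mz : M - 1 <= theta z.
  have h2 : eps * ex z <= 1 by rewrite -[1]mulr1 ler_pM // ltW.
  have h3 : 0 < eps * ex x1 by rewrite mulr_gt0.
  by move: Hx1; lra.
have hmax : \forall w \near z, theta w + eps * expR (- al * dot (w - y) (w - y)) <=
     theta z + eps * expR (- al * dot (z - y) (z - y)).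
  have n1 : \forall w \near z, rho0 < s w by apply: (cvgr_gt _ (cs z)).
  have n2 : \forall w \near z, s w < r by apply: (cvgr_lt _ (cs z)).
  apply: filterS2 n1 n2 => w w1 w2.
  by apply: zmax; rewrite !ltW.
have touch := barrier_touch Oz eps_gt al_gt hmax.
set g := eps * expR (- al * dot (z - y) (z - y)) * al in touch.
have g0 : 0 < g by exact: (mulr_gt0 (mulr_gt0 eps_gt (expR_gt0 _)) al_gt).
pose v := z - y; rewrite -/v in touch.
have vE : z - y = v by [].
clearbody v.
have sv : s z = dot v v by rewrite /s vE.
have zE : z = v + y by rewrite -vE subrK.
have drift : dW u 0 z (z - 0) = 2 * g * dot v z.
  by rewrite (touching_first_order oO C2 Oz touch) subr0 dotZl.
have [rho /andP[rho_gt rho4] rhoP] := good_radius Oz mz.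
have nP := near_touching 0 Oz g0 rho_gt.
have g20 : 0 < 2 * g by rewrite mulr_gt0.
have [t [w [t0 [Ow OT lw lT inc] hess]]] := touching oO C2 Oz touch g20 nP.
rewrite /= in Ow OT lw lT inc hess.
set T := w + t *: (w - 0) in OT lT inc hess.
pose e' := 4 * t * g; have e'0 : 0 <= e'.
  by apply: ltW; rewrite mulr_gt0 // mulr_gt0.
have hessT : mx_le (hessian u T) (hessian u w + e' *: (2%:M - al *: (v^T *m v))).
  move=> h; apply: le_trans (hess h) _.
  rewrite mulmxDr dotDl !quad_rank1 lerD2l le_eqVlt; apply/orP; left; apply/eqP.
  by rewrite /e'; ring.
have lamT i : lam T i <= lam w i + 2 * e'.
  have sp := spec_poly (2 * e') 1 0 (lam_spec Ow).
  have -> : lam w i + 2 * e' = 2 * e' + 1 * lam w i + 0 * lam w i ^+ 2 by ring.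
  apply: (weyl (lam_sorted OT) _ (lam_spec OT) sp).
    by move=> j k jk; rewrite !mul0r !mul1r !addr0 lerD2l; exact: lam_sorted.
  move=> h; apply: le_trans (hessT h) _.
  rewrite scale0r addr0 scale1r !(mulmxDr h) !dotDl quad_rank1 addrC lerD2r.
  rewrite mul_mx_scalar dotZl (mulrC 2 e') -(mulrA e' 2) ler_wpM2l // lerBlDr lerDl.
  by rewrite mulr_ge0 ?sqr_ge0 // ltW.
(* The rank-one gain is lost in the bound on individual eigenvalues but fully visible in the
   trace. *)
have trT : \sum_i lam T i <= \sum_i lam w i + e' * (2 * n%:R - al * s z).
  rewrite -(spec_trace (lam_spec OT)) -(spec_trace (lam_spec Ow)).
  apply: (le_trans (mx_le_trace hessT)).
  rewrite mxtraceD mxtraceZ linearB /= mxtrace_scalar mxtraceZ mxtrace_mulC.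
  by rewrite trace_mx11 -dot_mxE sv -(mulr_natr 2).
(* Only the part of the increment below its upper bound 2 e' is weighted by eta, so that summation
   produces the trace. *)
have dfl i : f (lam T i) - f (lam w i) <= eta * (lam T i - lam w i - 2 * e') + 2 * e' * K.
  have [xi [hx1 hx2] ->] := @mean_value z rho (lam w i) (lam T i) i
    (fun q hq => (rhoP i q hq).1) (lw i) (lT i).
  have [Dxi fxi] := rhoP i xi hx1.
  have dK : df xi <= K.
    have := KP xi Dxi fxi; apply: le_trans.
    have [e2 e20 e2P] := profile_lower pf `|xi|.
    have dxi : 0 <= df xi by rewrite (le_trans (ltW e20)) // e2P.
    by rewrite ler_peMr // lerDl sqr_ge0.
  have deta : eta <= df xi.
    apply: etaP => //; rewrite -[xi](subrK (lam z i)) (le_trans (ler_normD _ _)) //.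
    have := LP z i zr; lra.
  exact: slope_bound e'0 deta dK (lamT i).
have := inc (ltW t0); rewrite drift -(equation Ow) -(equation OT) -sumrB => h1.
have h2 : \sum_(i < n) (f (lam T i) - f (lam w i)) <= e' * (2 * (n%:R * K) - eta * al * s z).
  apply: (@le_trans _ _ (\sum_(i < n) (eta * (lam T i - lam w i - 2 * e') + 2 * e' * K))).
    by apply: ler_sum => i _.
  rewrite big_split /= -mulr_sumr !sumrB !sumr_const card_ord.
  rewrite -(mulr_natl (2 * e')) -(mulr_natl (2 * e' * K)).
  have : eta * (\sum_i lam T i - \sum_i lam w i - n%:R * (2 * e')) <= eta * (- (e' * (al * s z))).
    by rewrite ler_wpM2l ?(ltW eta_gt) //; lra.
  move=> h; apply: (le_trans (lerD h (lexx _))).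
  by rewrite le_eqVlt; apply/orP; left; apply/eqP; ring.
have := le_trans h1 h2.
rewrite (_ : t * _ = (t * g) * (2 * dot v z - 1)); last by ring.
rewrite (_ : e' * _ = (t * g) * (4 * (2 * (n%:R * K) - eta * al * s z))); last by rewrite /e'; ring.
rewrite (ler_pM2l (mulr_gt0 t0 g0)) => h3.
have h4 : 8 * (n%:R * K) + 2 + 2 * dot y y <= 4 * eta * al * s z.
  rewrite (_ : _ + _ = 4 * eta * al * rho0); first by apply: ler_wpM2l => //; apply: ltW; rewrite mulr_gt0 // mulr_gt0.
  by rewrite /al; field; rewrite !gt_eqF.
have h5 : dot v z = s z + dot v y by rewrite {1}zE dotDr sv.
have h6 := dot_double_le (- v) y.
move: h6; rewrite !dotNl dotNr opprK -sv => h6.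
by move: h3 h4; rewrite h5; have := dot_ge0 v; have := dot_ge0 y; rewrite -sv; lra.
Qed.

(** * Compactness, existence of a maximum, constancy of theta *)

Hypothesis blowup : blows_up_at_boundary Omega (fun x => enorm (gradient u x)) \/
   blows_up_at_boundary Omega (fun x => `|u x|).

Definition region (m C : R) : set 'rV[R]_n :=
  [set x | [/\ Omega x, m <= theta x & phi x <= C]].

(** At a limit point outside [Omega] one of |Du|, |u| would be unbounded, but phi <= C bounds Du,
    and together with m <= theta <= n b it bounds u = (x, Du) / 2 - theta. *)
Lemma region_closed m C : closed (region m C).
Proof.
move=> p pcl.
have meets (P : set 'rV[R]_n) : (\forall x \near p, P x) -> exists2 x, region m C x & P x.
  by move=> /pcl [x [? ?]]; exists x.
have [Op|nOp] := pselect (Omega p).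
  split=> //.
    rewrite leNgt; apply/negP => lt.
    have [x [_ mx _] xm] := meets _ (cvgr_lt _ (cvg_theta Op) m lt).
    by move: xm; rewrite ltNge mx.
  rewrite leNgt; apply/negP => lt.
  have [x [_ _ xC] Cx] := meets _ (cvgr_gt _ (cvg_phi Op) C lt).
  by move: Cx; rewrite ltNge xC.
have bp : boundary Omega p.
  split.
    by move=> B /pcl [x [[Ox _ _] Bx]]; exists x.
  by move=> /interior_subset.
have sq x : region m C x -> 0 <= C.
  by case=> _ _; apply: le_trans; exact: phi_ge0.
case: blowup => /(_ p bp) /cvgryPgt.
  move=> /(_ (Num.sqrt C)); rewrite near_withinE => /meets [x Sx].
  have [Ox _ xC] := Sx; move=> /(_ Ox); rewrite ltNge /enorm ler_sqrt ?(sq x) //.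
  by rewrite (le_trans _ xC) // lerDr dot_ge0.
move=> /(_ (C + `|m| + n%:R * b)); rewrite near_withinE => /meets [x Sx].
have [Ox mx xC] := Sx; move=> /(_ Ox); rewrite ltNge => /negP; case.
have uE : u x = 2^-1 * dot x (gradient u x) - theta x by rewrite thetaE; ring.
have tb := theta_le Ox.
have nb : 0 <= n%:R * b by rewrite mulr_ge0 // (profile_bound_ge0 pf).
have d1 := dot_double_le x (gradient u x).
have d2 := dot_double_le (- x) (gradient u x).
rewrite !dotNl dotNr opprK in d2.
have := ler_norm (- m); rewrite normrN; have := normr_ge0 m.
move: xC; rewrite /energy uE ler_norml.
move: (theta x) mx tb (dot x (gradient u x)) (dot x x) (dot (gradient u x) (gradient u x)) d1 d2.
move: (`|m|) (n%:R * b) nb => am nb nb0 th mx tb xg xx gg d1 d2 h1 h2 h3.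
by apply/andP; split; lra.
Qed.

Lemma region_compact m C : compact (region m C).
Proof.
apply: (subclosed_compact (@region_closed m C) (@dot_ball_compact R n 0 C)).
move=> x [_ _ xC] /=; rewrite subr0; apply: le_trans xC.
by rewrite /energy lerDl dot_ge0.
Qed.

Lemma penalized_max (eps : R) x1 : 0 < eps -> Omega x1 ->
  exists x0, [/\ Omega x0, theta x1 - eps * phi x1 <= theta x0 &
    forall y, Omega y -> theta y - eps * phi y <= theta x0 - eps * phi x0].
Proof.
move=> e0 Ox1; pose m := theta x1 - eps * phi x1.
(* Since theta <= n b, a value theta - eps phi >= m forces phi <= C. *)
pose C := (n%:R * b - m) / eps.
have inS y : Omega y -> m <= theta y - eps * phi y -> region m C y.
  move=> Oy my; split=> //.
    by rewrite (le_trans my) // gerBl mulr_ge0 ?phi_ge0 // ltW.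
  rewrite ler_pdivlMr // mulrC; have := theta_le Oy; move: my => ? ?; lra.
have [|||x0 x0S x0max] := @compact_EVT_max 'rV[R]_n R (fun y => theta y - eps * phi y) (region m C).
- by exists x1; apply: inS.
- exact: region_compact.
- apply: continuous_in_subspaceT => y /[!inE] -[Oy _ _].
  have c1 := cvg_theta Oy; have c2 := cvg_phi Oy.
  exact: cvgB c1 (cvgM (cvg_cst eps) c2).
rewrite inE in x0S; have [Ox0 mx0 _] := x0S.
exists x0; split=> // y Oy.
have [my|ym] := leP m (theta y - eps * phi y).
  by apply: x0max; rewrite inE; exact: inS.
apply: (le_trans (ltW ym)); apply: x0max; rewrite inE; exact: inS.
Qed.

(** For all eps in ]0, 1] the penalised maxima lie in one compact region, as m and [C0] do not
    depend on eps. The maximum of theta over that region is global: a larger value at y would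
    survive a small penalty. *)
Lemma theta_attains_max : Omega !=set0 ->
  exists2 x0, Omega x0 & forall y, Omega y -> theta y <= theta x0.
Proof.
case=> x1 Ox1; pose m := theta x1 - phi x1.
have [C0 C0p bar] := barrier_bound m.
have inS (eps : R) : 0 < eps <= 1 -> exists2 z, region m C0 z &
    forall y, Omega y -> theta y - eps * phi y <= theta z.
  move=> /andP[e0 e1]; have [z [Oz mz zmax]] := penalized_max e0 Ox1.
  have mz' : m <= theta z.
    by rewrite (le_trans _ mz) // lerB // ler_piMl // phi_ge0.
  exists z; first by split=> //; exact: bar zmax.
  move=> y Oy; rewrite (le_trans (zmax y Oy)) // gerBl mulr_ge0 ?phi_ge0 //.
  exact: ltW.
have [|||x0 x0S x0max] := @compact_EVT_max 'rV[R]_n R theta (region m C0).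
- by have [|z zS _] := inS 1; [rewrite ltr01 lexx|exists z].
- exact: region_compact.
- by apply: continuous_in_subspaceT => y /[!inE] -[Oy _ _]; exact: cvg_theta _ Oy.
rewrite inE in x0S; have [Ox0 _ _] := x0S.
exists x0 => // y Oy; rewrite leNgt; apply/negP => lt.
pose d := theta y - theta x0; have d0 : 0 < d by rewrite subr_gt0.
have p1 : 0 < 2 * (phi y + 1) by rewrite mulr_gt0 // ltr_wpDl // phi_ge0.
pose eps := Num.min 1 (d / (2 * (phi y + 1))).
have e0 : 0 < eps by rewrite lt_min ltr01 divr_gt0.
have [|z zS zP] := inS eps; first by rewrite e0 ge_min lexx.
have := zP y Oy; have := x0max z; rewrite inE => /(_ zS).
have : eps * (2 * (phi y + 1)) <= d by rewrite -ler_pdivlMr // ge_min lexx orbT.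
have := phi_ge0 y; rewrite /d; move: (phi y) (theta y) (theta x0) (theta z) lt => q a c w *.
nra.
Qed.

Hypothesis domO : domain Omega.

Lemma theta_constant : exists M, forall x, Omega x -> theta x = M.
Proof.
have [ne _ cO] := domO.
have [x0 Ox0 maxM] := theta_attains_max ne.
exists (theta x0); pose M := theta x0; rewrite -/M in maxM *.
pose Z := [set x | Omega x /\ theta x = M].
suff ZO : Z = Omega by move=> x; rewrite -ZO => -[].
pose L := [set x | Omega x /\ theta x < M].
have openL : open L.
  rewrite openE => x [Ox xM].
  apply: filterI; first exact: open_nbhs_nbhs (conj oO Ox).
  exact: (cvgr_lt _ (cvg_theta Ox)).
have openZ : open Z.
  rewrite openE => z [Oz zM]; apply/nbhs_dotP.
  have [r r0 rP] := (nbhs_dotP _ _).1 (open_nbhs_nbhs (conj oO Oz)).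
  have sum_sq x y : dot (x + y) (x + y) <= 2 * dot x x + 2 * dot y y.
    by rewrite dot_sqrD; have := dot_double_le x y; lra.
  (* With |y - z|^2 <= r / 16, the ball of squared radius r / 4 about y contains z and stays in
     [Omega]; if theta y < M, the strong maximum principle on it would contradict theta z = M. *)
  exists (r / 16) => [|y yr]; first by rewrite divr_gt0.
  have ball x : dot (x - y) (x - y) <= r / 4 -> Omega x.
    move=> xr; apply: rP; have := sum_sq (x - y) (y - z).
    rewrite addrA subrK => h; apply: (le_trans h); lra.
  have Oy : Omega y by apply: rP; lra.
  split=> //; apply/eqP; rewrite eq_le maxM //= leNgt; apply/negP => yM.
  have r4 : 0 < r / 4 by rewrite divr_gt0.
  have zr : dot (z - y) (z - y) < r / 4 by rewrite -opprB dotNl dotNr opprK; lra.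
  by have := strong_maximum_ball maxM r4 ball yM zr; rewrite zM ltxx.
apply: cO.
- by exists x0.
- exists Z => //; apply/seteqP; split=> x; last by case.
  by move=> Zx; split=> //; case: Zx.
- exists (~` L); first exact: open_closedC.
  apply/seteqP; split=> x.
    by move=> [Ox xM]; split=> // -[_]; rewrite xM ltxx.
  move=> [Ox nL]; split=> //; apply/eqP; rewrite eq_le maxM //= leNgt.
  by apply/negP => xM; apply: nL.
Qed.

Theorem eigen_equation_rigidity : Omega = setT /\ quadratic_polynomial u.
Proof.
have [M WM] := theta_constant; have [ne _ _] := domO.
have OT := domain_full oO C2 WM blowup ne.
by split=> //; exact: quadratic_of_constant_phase oO C2 WM blowup OT.
Qed.

End Equation.

(** * The three concrete profiles *)

Section Profiles.
Variable R : realType.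
Implicit Types (t a c k m : R).

(** Isolates the common derivative k / Q with Q = t^2 + 2 a t + 1. What depends on the case is the
    last premise: a lower bound on f keeps Q away from 0. *)
Lemma profile_intro (f : R -> R) (D : set R) k a c : 0 < k -> open D ->
  (forall t, D t -> 0 < t ^+ 2 + 2 * a * t + 1) ->
  (forall t, D t -> is_derive t 1 f (k / (t ^+ 2 + 2 * a * t + 1))) ->
  0 <= c -> (forall t, D t -> f t <= c) ->
  (forall m, exists2 q, 0 < q & forall t, D t -> m <= f t -> q <= t ^+ 2 + 2 * a * t + 1) ->
  profile f (fun t => k / (t ^+ 2 + 2 * a * t + 1)) D c.
Proof.
move=> k0 oD Qp fd c0 fc fq; split=> // [m|L].
  have [q q0 qP] := fq m.
  have a2 := sqr_ge0 a.
  (* From 1 + t^2 <= 2 Q + 4 a^2 and Q >= q. *)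
  exists (k * (2 + 4 * a ^+ 2 / q)).
    by rewrite mulr_ge0 ?(ltW k0) // addr_ge0 // divr_ge0 ?(ltW q0) // mulr_ge0.
  move=> t Dt mt; have Q0 := Qp t Dt; have qQ := qP t Dt mt.
  rewrite mulrAC ler_pdivrMr // -(mulrA k) ler_wpM2l ?(ltW k0) //.
  set Q := _ + 1 in Q0 qQ *.
  have h1 : 1 + t ^+ 2 <= 2 * Q + 4 * a ^+ 2.
    by have := sqr_ge0 (t + 2 * a); rewrite /Q; lra.
  apply: (le_trans h1); rewrite [leRHS]mulrDl lerD2l.
  rewrite -(mulrA (4 * a ^+ 2)); apply: ler_peMr; first by rewrite mulr_ge0.
  by rewrite mulrC ler_pdivlMr // mul1r.
pose S := L ^+ 2 + 2 * `|a| * `|L| + 1.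
have S0 : 0 < S by rewrite /S ltr_wpDl // addr_ge0 ?sqr_ge0 // !mulr_ge0.
exists (k / S) => [|t Dt tL]; first by rewrite divr_gt0.
have Q0 := Qp t Dt; rewrite ler_pM2l // lef_pV2 ?posrE // /S lerD2r lerD //.
  by rewrite -(real_normK (num_real t)) -(real_normK (num_real L)) ler_sqr ?nnegrE //
    (le_trans tL) // ler_norm.
rewrite -!mulrA ler_wpM2l // (le_trans (ler_norm _)) // normrM ler_wpM2l //.
by rewrite (le_trans tL) // ler_norm.
Qed.

Lemma is_derive_shift a t : is_derive t 1 (fun s => s + a) 1.
Proof.
have := is_derive_linear a 1 t.
by rewrite (_ : (fun s => a + s * 1) = (fun s => s + a)) //; apply/funext => s; rewrite mulr1 addrC.
Qed.

(** The value a = 1 is case (1) as it stands, and a = -1 is the second alternative seen from - u. *)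
Lemma inv_profile a : a ^+ 2 = 1 ->
  profile (fun t => - Num.sqrt 2 * (t + a)^-1)
    (fun t => Num.sqrt 2 / (t ^+ 2 + 2 * a * t + 1)) [set t | - a < t] 0.
Proof.
move=> a1; have QE t : t ^+ 2 + 2 * a * t + 1 = (t + a) ^+ 2.
  have -> : (t + a) ^+ 2 = t ^+ 2 + 2 * a * t + a ^+ 2 by ring.
  by rewrite a1.
have s0 : 0 < Num.sqrt (2 : R) by rewrite sqrtr_gt0.
have ta t : - a < t -> 0 < t + a by move=> ?; lra.
apply: (profile_intro s0 (@open_gt R _)).
- by move=> t /= /ta h; rewrite QE exprn_gt0.
- move=> t /= /ta h; rewrite QE.
  have h0 : t + a != 0 by rewrite gt_eqF.
  have := is_derive_mulc (@is_deriveV R (fun s => s + a) t 1 1 h0 (is_derive_shift a t)) (- Num.sqrt 2).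
  by move=> /is_derive_eq; apply; rewrite [_ *: _]mulr1 mulrNN.
- exact: lexx.
- by move=> t /= /ta h; rewrite mulNr oppr_le0 mulr_ge0 ?invr_ge0 ?ltW.
- move=> m; pose q := Num.sqrt 2 / (`|m| + 1).
  have m1 : 0 < `|m| + 1 by rewrite ltr_wpDl.
  have q0 : 0 < q by rewrite divr_gt0.
  exists (q ^+ 2) => [|t /= /ta h mt]; first by rewrite exprn_gt0.
  rewrite QE ler_sqr ?nnegrE ?(ltW q0) ?(ltW h) // /q ler_pdivrMr // mulrC -ler_pdivrMr //.
  have := ler_norm (- m); rewrite normrN; move: mt; rewrite mulNr; lra.
Qed.

(** The sign of a is free: a = cot tau gives the first alternative, a = - cot tau the second one
    after passing to - u. *)
Lemma ln_profile a c : 0 < c -> a ^+ 2 = c ^+ 2 + 1 ->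
  profile (fun t => Num.sqrt (a ^+ 2 + 1) / (2 * c) * ln ((t + a - c) / (t + a + c)))
    (fun t => Num.sqrt (a ^+ 2 + 1) / (t ^+ 2 + 2 * a * t + 1)) [set t | - (a - c) < t] 0.
Proof.
move=> c0 ac; set k := Num.sqrt _.
have k0 : 0 < k by rewrite sqrtr_gt0 ltr_wpDl // sqr_ge0.
have QE t : t ^+ 2 + 2 * a * t + 1 = (t + a - c) * (t + a + c).
  by apply/eqP; rewrite -subr_eq0; apply/eqP; transitivity (c ^+ 2 + 1 - a ^+ 2); [ring|rewrite ac; ring].
have p1 t : - (a - c) < t -> 0 < t + a - c by move=> ?; lra.
have p2 t : - (a - c) < t -> 2 * c < t + a + c by move=> ?; lra.
have p3 t : - (a - c) < t -> 0 < t + a + c by move=> ?; lra.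
have kc0 : 0 < k / (2 * c) by rewrite divr_gt0 // mulr_gt0.
apply: (profile_intro k0 (@open_gt R _)).
- by move=> t /= h; rewrite QE mulr_gt0 ?p1 ?p3.
- move=> t /= h; have h1 := p1 t h; have h3 := p3 t h.
  have n3 : t + a + c != 0 by rewrite gt_eqF.
  have d1 : is_derive t 1 (fun s => s + a - c) 1.
    by have := is_derive_shift (a - c) t; under eq_fun do rewrite addrA.
  have d2 : is_derive t 1 (fun s => s + a + c) 1.
    by have := is_derive_shift (a + c) t; under eq_fun do rewrite addrA.
  have dr := is_derive_mul d1 (@is_deriveV R (fun s => s + a + c) t 1 1 n3 d2).
  have dl := @is_derive1_comp R _ _ t _ _ (is_derive1_ln (divr_gt0 h1 h3)) dr.
  apply: is_derive_eq (is_derive_mulc dl (k / (2 * c))) _.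
  rewrite QE -exprVn [_ *: _]mulr1 mul1r.
  by field; rewrite !gt_eqF.
- exact: lexx.
- move=> t /= h; rewrite pmulr_rle0 // ln_le0 // ler_pdivrMr ?p3 // mul1r.
  by rewrite lerD2l; lra.
(* f >= m means that the ratio of the two factors of Q is at least q; the larger factor exceeds 2 c,
   so the smaller one is at least 2 c q. *)
- move=> m; pose q := expR (m / (k / (2 * c))).
  have q0 : 0 < q := expR_gt0 _.
  exists (q * (2 * c) * (2 * c)) => [|t /= h mt]; first by rewrite !mulr_gt0.
  have h1 := p1 t h; have h2 := p2 t h; have h3 := p3 t h.
  have : m / (k / (2 * c)) <= ln ((t + a - c) / (t + a + c)) by rewrite ler_pdivrMr // mulrC.
  rewrite -ler_expR lnK ?posrE ?divr_gt0 // -/q ler_pdivlMr // => qs.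
  have c2 : 0 <= 2 * c by rewrite mulr_ge0 // ltW.
  have h4 : q * (2 * c) <= t + a - c.
    by apply: le_trans _ qs; rewrite ler_wpM2l ?(ltW q0) ?(ltW h2).
  rewrite QE; apply: ler_pM => //; last exact: ltW.
  by rewrite mulr_ge0 // ltW.
Qed.

(** Here Q = (t + a)^2 + c^2 has no real root, so Q >= c^2 without any bound on f; f jumps at - (a +
    c), but its derivative has the same formula on both sides. *)
Lemma atan_profile a c : 0 < c -> a ^+ 2 + c ^+ 2 = 1 ->
  profile (fun t => Num.sqrt (a ^+ 2 + 1) / c * atan ((t + a - c) / (t + a + c)))
    (fun t => Num.sqrt (a ^+ 2 + 1) / (t ^+ 2 + 2 * a * t + 1)) [set t | t != - (a + c)]
    (Num.sqrt (a ^+ 2 + 1) / c * (pi / 2)).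
Proof.
move=> c0 ac; set k := Num.sqrt _.
have k0 : 0 < k by rewrite sqrtr_gt0 ltr_wpDl // sqr_ge0.
have QE t : t ^+ 2 + 2 * a * t + 1 = (t + a) ^+ 2 + c ^+ 2.
  have -> : (t + a) ^+ 2 + c ^+ 2 = t ^+ 2 + 2 * a * t + (a ^+ 2 + c ^+ 2) by ring.
  by rewrite ac.
have c2 : 0 < c ^+ 2 by rewrite exprn_gt0.
have Qc t : c ^+ 2 <= t ^+ 2 + 2 * a * t + 1 by rewrite QE lerDr sqr_ge0.
have kc0 : 0 < k / c by rewrite divr_gt0.
apply: (profile_intro k0 (@open_neq R _)).
- by move=> t _; exact: lt_le_trans (Qc t).
- move=> t /= h.
  have n3 : t + a + c != 0.
    by apply: contra h => /eqP h; apply/eqP; lra.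
  have d1 : is_derive t 1 (fun s => s + a - c) 1.
    by have := is_derive_shift (a - c) t; under eq_fun do rewrite addrA.
  have d2 : is_derive t 1 (fun s => s + a + c) 1.
    by have := is_derive_shift (a + c) t; under eq_fun do rewrite addrA.
  have dr := is_derive_mul d1 (@is_deriveV R (fun s => s + a + c) t 1 1 n3 d2).
  have dl := @is_derive1_comp R _ _ t _ _ (is_derive1_atan _) dr.
  apply: is_derive_eq (is_derive_mulc dl (k / c)) _.
  rewrite QE -exprVn [_ *: _]mulr1 mul1r.
  have Q0 : (t + a) ^+ 2 + c ^+ 2 != 0 by rewrite -QE gt_eqF // (lt_le_trans c2).
  have E1 : (t + a + c) ^+ 2 + (t + a - c) ^+ 2 != 0.
    rewrite (_ : _ + _ = 2 * ((t + a) ^+ 2 + c ^+ 2)); last by ring.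
    by rewrite mulf_neq0 // pnatr_eq0.
  by field; rewrite Q0 n3 E1 gt_eqF.
- by rewrite mulr_ge0 ?(ltW kc0) // divr_ge0 // ltW // pi_gt0.
- by move=> t _; rewrite ler_wpM2l ?(ltW kc0) // ltW // atan_ltpi2.
- by move=> m; exists (c ^+ 2).
Qed.

End Profiles.

(** * From eigenvalues in any order, and from - u, to the abstract equation *)

Section Reduction.
Variables (R : realType) (n : nat).
Implicit Types (Omega : set 'rV[R]_n) (u g h : 'rV[R]_n -> R).

Lemma rigidity_of_profile Omega u (f df : R -> R) (D : set R) (b : R)
    (lam : 'rV[R]_n -> 'I_n -> R) :
  domain Omega -> C2_on Omega u -> profile f df D b ->
  (forall x, Omega x -> eigenvalues (hessian u x) (lam x)) ->
  (forall x i, Omega x -> D (lam x i)) ->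
  (forall x, Omega x -> \sum_(i < n) f (lam x i) = - u x + 2^-1 * dot x (gradient u x)) ->
  (blows_up_at_boundary Omega (fun x => enorm (gradient u x)) \/
   blows_up_at_boundary Omega (fun x => `|u x|)) ->
  Omega = setT /\ quadratic_polynomial u.
Proof.
move=> domO C2 pf eig lamD equ blowup.
have [ne oO _] := domO.
(* The implication sits inside the existential so that [choice] yields a total function; outside
   [Omega] any list is accepted. *)
have sorted_exists x : exists m : 'I_n -> R, Omega x ->
    [/\ {homo m : i j / (i <= j)%N >-> i <= j}, eigenvalues (hessian u x) m &
        exists s : {perm 'I_n}, forall i, m i = lam x (s i)].
  have [Ox|nOx] := pselect (Omega x); last by exists (fun=> 0).
  by have [m hm] := eigenvalues_sort (eig x Ox); exists m.
have [m mP] := choice sorted_exists.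
apply: (@eigen_equation_rigidity R n Omega u f df D b m) => //.
split=> // [x Ox|x Ox|x i Ox|x Ox]; have [hs he [s sE]] := mP x Ox.
- exact: symmetric_spec (hessian_sym oO C2 Ox) he.
- exact: hs.
- by rewrite sE; exact: lamD.
- rewrite /W subr0 -(equ x Ox) [RHS](reindex_inj (@perm_inj _ s)).
  by apply: eq_bigr => i _; rewrite sE.
Qed.

(** The partial derivatives of - u are known to be minus those of u on [Omega] only, so their
    regularity is transferred from functions agreeing there. *)
Lemma C1_on_ext Omega g h : open Omega -> (forall x, Omega x -> g x = h x) ->
  C1_on Omega g -> C1_on Omega h.
Proof.
move=> oO gh C1.
have near_gh x : Omega x -> \forall y \near x, g y = h y.
  by move=> Ox; apply: filterS (open_nbhs_nbhs (conj oO Ox)) => y; exact: gh.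
have pgh x i : Omega x -> partial i g x = partial i h x.
  by move=> Ox; apply: near_eq_derive; exact: near_gh.
move=> x Ox; have [cg dg] := C1 x Ox; split.
  by apply: (cvg_trans (near_eq_cvg (near_gh x Ox))); rewrite -(gh x Ox); exact: cg.
move=> i; have [dgi cgi] := dg i; split.
  exact: near_eq_derivable (near_gh x Ox) dgi.
have near_p : \forall y \near x, partial i g y = partial i h y.
  by apply: filterS (open_nbhs_nbhs (conj oO Ox)) => y; exact: pgh.
by apply: (cvg_trans (near_eq_cvg near_p)); rewrite -(pgh x i Ox); exact: cgi.
Qed.

Lemma partial_opp g x i : derivable g x 'e_i -> partial i (fun y => - g y) x = - partial i g x.
Proof. by move=> dg; rewrite /partial; exact: deriveN. Qed.

Lemma C1_on_opp Omega g : open Omega -> C1_on Omega g -> C1_on Omega (fun x => - g x).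
Proof.
move=> oO C1 x Ox; have [cg dg] := C1 x Ox; split; first exact: cvgN cg.
move=> i; have [dgi cgi] := dg i; split; first exact: derivableN.
have E y : Omega y -> - partial i g y = partial i (fun y => - g y) y.
  by move=> Oy; have [_ /(_ i) [dy _]] := C1 y Oy; rewrite partial_opp.
have near_p : \forall y \near x, - partial i g y = partial i (fun y => - g y) y.
  by apply: filterS (open_nbhs_nbhs (conj oO Ox)) => y; exact: E.
by apply: (cvg_trans (near_eq_cvg near_p)); rewrite -(E x Ox); exact: cvgN cgi.
Qed.

Section Opposite.
Variables (Omega : set 'rV[R]_n) (u : 'rV[R]_n -> R).
Hypotheses (oO : open Omega) (C2 : C2_on Omega u).
Let w x := - u x.

Lemma partial_oppE i x : Omega x -> partial i w x = - partial i u x.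
Proof. by move=> Ox; have [_ /(_ i) [d _]] := C2.1 x Ox; rewrite partial_opp. Qed.

Lemma C2_on_opp : C2_on Omega w.
Proof.
split=> [|i]; first exact: C1_on_opp C2.1.
apply: (@C1_on_ext Omega (fun x => - partial i u x)) => // [x Ox|].
  by rewrite partial_oppE.
exact: C1_on_opp (C2.2 i).
Qed.

Lemma gradient_opp x : Omega x -> gradient w x = - gradient u x.
Proof. by move=> Ox; apply/rowP => i; rewrite !mxE partial_oppE. Qed.

Lemma hessian_opp x : Omega x -> hessian w x = - hessian u x.
Proof.
move=> Ox; apply/matrixP => i j; rewrite !mxE.
have [_ /(_ j) [d _]] := C2.2 i x Ox.
rewrite -(partial_opp d); apply: near_eq_derive.
by apply: filterS (open_nbhs_nbhs (conj oO Ox)) => y Oy; rewrite partial_oppE.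
Qed.

End Opposite.

Lemma spec_eigenvalues (A : 'M[R]_n) l : spec A l -> eigenvalues A l.
Proof.
case=> P PP ->; rewrite /eigenvalues.
have QQ : P^T *m P^T^T = 1%:M by rewrite trmxK orthogonal_trV.
have := char_poly_similar (diag_mx (\row_i l i)) QQ; rewrite trmxK => ->.
rewrite char_poly_trig ?diag_mx_is_trig //.
by apply: eq_bigr => i _; rewrite !mxE eqxx.
Qed.

Lemma eigenvalues_opp (A : 'M[R]_n) (l : 'I_n -> R) : A^T = A ->
  eigenvalues A l -> eigenvalues (- A) (fun i => - l i).
Proof.
move=> As /(symmetric_spec As) sp; apply: spec_eigenvalues.
have := spec_poly 0 (-1) 0 sp.
rewrite scale0r addr0 scaleN1r (_ : 0%:M = 0) ?add0r; last by apply/matrixP => i j; rewrite !mxE mul0rn.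
rewrite (_ : (fun i => _) = (fun i => - l i)) //.
by apply/funext => i; ring.
Qed.

Lemma eigenvalues_gt (A : 'M[R]_n) l c i : eigenvalues A l -> mx_lt c%:M A -> c < l i.
Proof.
move=> eA cA.
have : eigenvalue A (l i).
  rewrite eigenvalue_root_char eA (bigD1 i) //= rootM root_XsubC eqxx //.
case/eigenvalueP => v vA v0; have := cA v v0.
rewrite mulmxBr vA mul_mx_scalar -scalerBl dotZl pmulr_lgt0 ?dot_gt0 //.
by rewrite subr_gt0.
Qed.

Lemma eigenvalues_lt (A : 'M[R]_n) l c i : eigenvalues A l -> mx_lt A c%:M -> l i < c.
Proof.
move=> eA cA.
have : eigenvalue A (l i).
  rewrite eigenvalue_root_char eA (bigD1 i) //= rootM root_XsubC eqxx //.
case/eigenvalueP => v vA v0; have := cA v v0.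
rewrite mulmxBr vA mul_mx_scalar -scalerBl dotZl pmulr_lgt0 ?dot_gt0 //.
by rewrite subr_gt0.
Qed.

(** The right-hand side is linear in u and the eigenvalues of - u are the - lam x i, so - u solves
    the equation with profile g(s) = - f(- s). *)
Lemma rigidity_of_opposite_profile Omega u (f g dg : R -> R) (D : set R) (b : R)
    (lam : 'rV[R]_n -> 'I_n -> R) :
  domain Omega -> C2_on Omega u -> profile g dg D b ->
  (forall x, Omega x -> eigenvalues (hessian u x) (lam x)) ->
  (forall x i, Omega x -> D (- lam x i) /\ g (- lam x i) = - f (lam x i)) ->
  (forall x, Omega x -> \sum_(i < n) f (lam x i) = - u x + 2^-1 * dot x (gradient u x)) ->
  (blows_up_at_boundary Omega (fun x => enorm (gradient u x)) \/
   blows_up_at_boundary Omega (fun x => `|u x|)) ->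
  Omega = setT /\ quadratic_polynomial u.
Proof.
move=> domO C2 pg eig lamD equ blowup; have [_ oO _] := domO.
have C2' := C2_on_opp oO C2.
have [||||OT [p sp pE]] := @rigidity_of_profile Omega (fun x => - u x) g dg D b
  (fun x i => - lam x i) domO C2' pg.
- move=> x Ox; rewrite (hessian_opp oO C2 Ox); apply: eigenvalues_opp (eig x Ox).
  exact: hessian_sym oO C2 Ox.
- by move=> x i Ox; have [] := lamD x i Ox.
- move=> x Ox; rewrite (gradient_opp C2 Ox) dotNr mulrN -opprD -(equ x Ox) -sumrN.
  by apply: eq_bigr => i _; have [] := lamD x i Ox.
- case: blowup => bl; [left|right] => p bp.
    apply: cvg_trans (bl p bp); apply: near_eq_cvg; rewrite near_withinE.
    apply: filterE => x Ox; rewrite (gradient_opp C2 Ox).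
    by rewrite /enorm dotNl dotNr opprK.
  apply: cvg_trans (bl p bp); apply: near_eq_cvg; rewrite near_withinE.
  by apply: filterE => x Ox; rewrite normrN.
split=> //; exists (- p) => [|x]; first by rewrite mmeasureN.
by rewrite mevalN -pE opprK.
Qed.

End Reduction.

(** * Trigonometric signs and the final theorem *)

Section Cot.
Variable R : realType.

(** The sign of cot^2 - 1 is that of cos (2 t), which changes at pi / 4. *)
Lemma cot_sqr_sub1 (t : R) : 0 < t < pi -> cot t ^+ 2 - 1 = cos (t + t) / sin t ^+ 2.
Proof.
move=> tpi; have s0 : sin t != 0 by rewrite gt_eqF // sin_gt0_pi.
by rewrite /cot cosD; field.
Qed.

Lemma cot_gt1 (t : R) : 0 < t -> t < pi / 4 -> 0 < cot t ^+ 2 - 1.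
Proof.
move=> t0 t4; have tpi : 0 < t < pi by apply/andP; split=> //; lra.
rewrite cot_sqr_sub1 // divr_gt0 ?exprn_gt0 ?sin_gt0_pi //.
by apply: cos_gt0_pihalf; apply/andP; split; lra.
Qed.

Lemma cot_lt1 (t : R) : pi / 4 < t -> t < pi / 2 -> 0 < 1 - cot t ^+ 2.
Proof.
move=> t4 t2; have p0 := pi_gt0 R.
have tpi : 0 < t < pi by apply/andP; split; lra.
rewrite -opprB oppr_gt0 cot_sqr_sub1 // pmulr_llt0 ?invr_gt0 ?exprn_gt0 ?sin_gt0_pi //.
have -> : cos (t + t) = - cos (pi - (t + t)).
  by rewrite [in RHS]cosB cospi sinpi mul0r addr0 mulN1r opprK.
by rewrite oppr_lt0; apply: cos_gt0_pihalf; apply/andP; split; lra.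
Qed.

(** Replacing x and a by their opposites exchanges numerator and denominator up to sign, hence
    inverts the ratio. *)
Lemma ln_opp_ratio (x a b : R) : 0 < b -> x < - (a + b) ->
  ln ((- x - a - b) / (- x - a + b)) = - ln ((x + a - b) / (x + a + b)).
Proof.
move=> b0 xab; have p1 : 0 < - x - a - b by lra.
have p2 : 0 < - x - a + b by lra.
have -> : (x + a - b) / (x + a + b) = ((- x - a - b) / (- x - a + b))^-1.
  have n1 : x + a - b != 0 by rewrite lt_eqF //; lra.
  have n2 : x + a + b != 0 by rewrite lt_eqF //; lra.
  by rewrite invf_div; field; rewrite n2 gt_eqF.
by rewrite lnV ?opprK // posrE divr_gt0.
Qed.

Lemma opp_scalar_mx n (a : R) : - a%:M = (- a)%:M :> 'M[R]_n.
Proof. by apply/matrixP => i j; rewrite !mxE mulNrn. Qed.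

End Cot.

Theorem theorem1p5 (R : realType) (n : nat) (Omega : set 'rV[R]_n)
    (u : 'rV[R]_n -> R) (lambda : 'rV[R]_n -> 'I_n -> R) :
  (1 <= n)%N ->
  domain Omega ->
  C2_on Omega u ->
  (forall x, Omega x -> eigenvalues (hessian u x) (lambda x)) ->
  [\/ (forall x, Omega x ->
         - Num.sqrt 2 * (\sum_(i < n) (1 + lambda x i)^-1)
         = - u x + 2^-1 * dot x (gradient u x)) /\
      ((forall x, Omega x -> mx_lt (- 1%:M) (hessian u x)) \/
       (forall x, Omega x -> mx_lt (hessian u x) (- 1%:M))),
      exists tau : R, [/\ 0 < tau, tau < pi / 4 &
        let a := cot tau in
        let b := Num.sqrt (cot tau ^+ 2 - 1) in
        (forall x, Omega x ->
           Num.sqrt (a ^+ 2 + 1) / (2 * b)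
             * (\sum_(i < n) ln ((lambda x i + a - b) / (lambda x i + a + b)))
           = - u x + 2^-1 * dot x (gradient u x)) /\
        ((forall x, Omega x -> mx_lt (- (a - b)%:M) (hessian u x)) \/
         (forall x, Omega x -> mx_lt (hessian u x) (- (a + b)%:M)))]
    | exists tau : R, [/\ pi / 4 < tau, tau < pi / 2 &
        let a := cot tau in
        let b := Num.sqrt (1 - cot tau ^+ 2) in
        (forall x i, Omega x -> lambda x i != - (a + b)) /\
        (forall x, Omega x ->
           Num.sqrt (a ^+ 2 + 1) / b
             * (\sum_(i < n) atan ((lambda x i + a - b) / (lambda x i + a + b)))
           = - u x + 2^-1 * dot x (gradient u x))]] ->
  (blows_up_at_boundary Omega (fun x => enorm (gradient u x)) \/
   blows_up_at_boundary Omega (fun x => `|u x|)) ->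
  Omega = setT /\ quadratic_polynomial u.
Proof.
move=> _ domO C2 eig cases blowup.
case: cases => [[equ adm]|[tau [t0 t1 [equ adm]]]|[tau [t0 t1 [lamD equ]]]].
- have equ' x : Omega x -> \sum_(i < n) (- Num.sqrt 2 * (lambda x i + 1)^-1) =
      - u x + 2^-1 * dot x (gradient u x).
    move=> Ox; rewrite -(equ x Ox) mulr_sumr.
    by apply: eq_bigr => i _; rewrite addrC.
  case: adm => adm.
    apply: (rigidity_of_profile domO C2 (@inv_profile R 1 (expr1n _ _)) eig _ equ' blowup).
    by move=> x i Ox; apply: eigenvalues_gt (eig x Ox) _; rewrite -opp_scalar_mx; exact: adm.
  have a1 : (- 1) ^+ 2 = 1 :> R by rewrite sqrrN expr1n.
  apply: (rigidity_of_opposite_profile (f := fun s => - Num.sqrt 2 * (s + 1)^-1) domO C2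
    (inv_profile a1) eig _ equ' blowup).
  move=> x i Ox; split.
    rewrite /= ltrN2; apply: eigenvalues_lt (eig x Ox) _.
    by rewrite -opp_scalar_mx; exact: adm.
  have -> : - lambda x i + - 1 = - (lambda x i + 1) by ring.
  by rewrite invrN mulrN.
- set b := Num.sqrt (_ - 1) in equ adm; set a := cot tau in b equ adm.
  have ba0 := cot_gt1 t0 t1.
  have b0 : 0 < b by rewrite sqrtr_gt0; exact: ba0.
  have ab : a ^+ 2 = b ^+ 2 + 1 by rewrite /b sqr_sqrtr ?subrK //; exact: ltW ba0.
  have equ' x : Omega x -> \sum_(i < n) (Num.sqrt (a ^+ 2 + 1) / (2 * b) *
      ln ((lambda x i + a - b) / (lambda x i + a + b))) = - u x + 2^-1 * dot x (gradient u x).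
    by move=> Ox; rewrite -(equ x Ox) mulr_sumr.
  case: adm => adm.
    apply: (rigidity_of_profile domO C2 (ln_profile b0 ab) eig _ equ' blowup).
    by move=> x i Ox; apply: eigenvalues_gt (eig x Ox) _; rewrite -opp_scalar_mx; exact: adm.
  (* The negated eigenvalues exceed a + b, which is the larger root of t^2 - 2 a t + 1, so the right
     branch of the profile with parameter - a applies. *)
  have ab' : (- a) ^+ 2 = b ^+ 2 + 1 by rewrite sqrrN.
  apply: (rigidity_of_opposite_profile (f := fun s => Num.sqrt (a ^+ 2 + 1) / (2 * b) *
    ln ((s + a - b) / (s + a + b))) domO C2 (ln_profile b0 ab') eig _ equ' blowup).
  move=> x i Ox.
  have lt : lambda x i < - (a + b).
    by apply: eigenvalues_lt (eig x Ox) _; rewrite -opp_scalar_mx; exact: adm.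
  split; first by rewrite /=; lra.
  by rewrite sqrrN ln_opp_ratio // mulrN.
- set b := Num.sqrt (1 - _) in lamD equ; set a := cot tau in b lamD equ.
  have ba0 := cot_lt1 t0 t1.
  have b0 : 0 < b by rewrite sqrtr_gt0; exact: ba0.
  have ab : a ^+ 2 + b ^+ 2 = 1 by rewrite /b sqr_sqrtr; [ring|exact: ltW ba0].
  apply: (rigidity_of_profile domO C2 (atan_profile b0 ab) eig _ _ blowup).
    by move=> x i Ox; exact: lamD.
  by move=> x Ox; rewrite -(equ x Ox) mulr_sumr.
Qed.
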